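(* Let $k$ be a field of characteristic $0$, let $n \geqslant 1$ be an integer, and let $r(n) = n\, j(n)$, where $j(n)$ is the Jordan constant for $n$-dimensional rationally connected varieties described in the context. Let $G$ be a finite group of exponent $e$, and suppose that $k$ contains a primitive $e$th root of unity. (a) If $\operatorname{ed}_k(G) \leqslant n$, then $\operatorname{rdim}_k(G) \leqslant r(n)$. (b) Moreover, if $\operatorname{ed}_k(G) \leqslant n$, then $G$ is isomorphic to a finite subgroup of $\mathbb{G}_m^{r(n)} \rtimes \mathrm{S}_{r(n)}$, where the symmetric group $\mathrm{S}_{r(n)}$ acts on $\mathbb{G}_m^{r(n)}$ by permuting the factors.
   Context: Jordan constant $j(n)$: by a theorem of Prokhorov--Shramov and Birkar (which may be taken as known), for every integer $n \geqslant 1$ there exists a positive integer $j(n)$ with the following property: if $X$ is any $n$-dimensional rationally connected variety and $G$ is any finite subgroup of the group $\operatorname{Bir}(X)$ of birational automorphisms of $X$, then $G$ has a normal abelian subgroup $A$ with $[G:A] \leqslant j(n)$. Here varieties and birational automorphisms are defined over the base field $k$ of characteristic $0$, and $j(n)$ denotes a fixed integer with this property. Representation dimension: for a finite group $G$, $\operatorname{rdim}_k(G)$ is the minimal dimension of a faithful representation of $G$ defined over $k$, i.e., the smallest positive integer $r$ such that $G$ is isomorphic to a subgroup of $\mathrm{GL}_r(k)$. Essential dimension: a faithful $G$-variety is an algebraic variety $X$ over $k$ with a faithful action of $G$ (defined over $k$). It is called linearizable if there exists a $G$-equivariant dominant rational map $V \dashrightarrow X$ over $k$, where $V$ is a (finite-dimensional)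 $k$-vector space with a linear action of $G$. The essential dimension $\operatorname{ed}_k(G)$ is the minimal dimension of a faithful linearizable $G$-variety defined over $k$. $\mathbb{G}_m$ is the multiplicative group over $k$, and finite subgroups in (b) are subgroups of the group of $k$-points $(k^* )^{r(n)} \rtimes \mathrm{S}_{r(n)}$. *)

(* Defs.v *)
From HB Require Import structures.
From mathcomp Require Import all_boot all_order all_algebra.
From mathcomp Require Import all_fingroup all_solvable all_character.
From mathcomp Require Import mpoly.

Set Implicit Arguments.
Unset Strict Implicit.
Unset Printing Implicit Defensive.

Import GRing.Theory.
Local Open Scope ring_scope.
Local Open Scope quotient_scope.

(* Integral varieties over k are encoded in the style of Zariski and Chevalley
   (EGA I, 8): a variety is its function field K together with the set of its
   local rings, viewed as subrings of K. A point is identified with its local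
   ring, and the generic point is K itself. A dominant map is identified with
   its pullback between function fields; whether that pullback is defined at a
   point is a condition on local rings. *)

(* The k-subalgebra k[L] of K generated by L. *)
Inductive adjoin (k : fieldType) (K : fieldType) (c : k -> K) (L : seq K) :
    K -> Prop :=
  | adjoin_const a : adjoin c L (c a)
  | adjoin_gen x : x \in L -> adjoin c L x
  | adjoin_add x y : adjoin c L x -> adjoin c L y -> adjoin c L (x + y)
  | adjoin_mul x y : adjoin c L x -> adjoin c L y -> adjoin c L (x * y).

Definition generates (k K : fieldType) (c : k -> K) (L : seq K) :=
  forall x, exists a b, [/\ adjoin c L a, adjoin c L b, b != 0 & x = a / b].

(* A finite union of affine integral k-schemes Spec k[L] sharing the function
   field K, each chart being given by its list L of generators. *)
Record prevariety (k : fieldType) := Prevariety {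
  funfield : fieldType;
  const : {rmorphism k -> funfield};
  charts : seq (seq funfield);
  charts_neq0 : charts != [::];
  charts_gen : forall L, L \in charts -> generates const L
}.

Section Points.
Variables (k : fieldType) (X : prevariety k).
Local Notation K := (funfield X).
Implicit Types (A P R S : K -> Prop) (L : seq K).

Definition prime_ideal A P :=
  [/\ forall x, P x -> A x,
      P 0 /\ (forall x y, P x -> P y -> P (x + y)),
      forall a x, A a -> P x -> P (a * x),
      ~ P 1
    & forall a b, A a -> A b -> P (a * b) -> P a \/ P b].

Definition localization A P (x : K) :=
  exists a b, [/\ A a, A b, ~ P b & x = a / b].

Definition point R :=
  exists L P, [/\ L \in charts X, prime_ideal (adjoin (const X) L) P
                & forall x, R x <-> localization (adjoin (const X) L) P x].

(* Zariski topology: the sets of the points whose local ring contains a given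
   finite list of rational functions form a basis of open sets. *)
Definition zariski_open (U : (K -> Prop) -> Prop) :=
  (forall R, U R -> point R) /\
  (forall R, U R -> exists L, (forall x, x \in L -> R x) /\
     forall R', point R' -> (forall x, x \in L -> R' x) -> U R').

(* The last clause says that the non-units form an ideal. *)
Definition local_subring R :=
  [/\ R 1, forall x y, R x -> R y -> R (x - y),
      forall x y, R x -> R y -> R (x * y)
    & forall x y, R x -> R y -> x + y != 0 -> R (x + y)^-1 ->
        (x != 0 /\ R x^-1) \/ (y != 0 /\ R y^-1)].

(* n is the transcendence degree of k(X) over k. *)
Definition alg_independent m (x : 'I_m -> K) :=
  forall p : {mpoly k[m]}, mmap (const X) x p = 0 -> p = 0.

Definition has_dim n :=
  (exists x : 'I_n -> K, alg_independent x) /\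
  (forall x : 'I_n.+1 -> K, ~ alg_independent x).

Definition lin_independent m (x : 'I_m -> K) :=
  forall a : 'I_m -> k, \sum_i const X (a i) * x i = 0 -> forall i, a i = 0.

End Points.

(* f S is contained in R and f : S -> R is a local homomorphism. As f is
   injective and 0^-1 = 0, the second clause also makes sense at s = 0. *)
Definition dominates (K K' : fieldType) (f : K -> K') (R : K' -> Prop)
    (S : K -> Prop) :=
  (forall s, S s -> R (f s)) /\ (forall s, S s -> R (f s)^-1 -> S s^-1).

(* Chevalley's separatedness axiom: two local rings of X dominated by a common
   local subring of the function field are equal. *)
Definition separated (k : fieldType) (X : prevariety k) :=
  forall R R' Q : funfield X -> Prop, point R -> point R' -> local_subring Q ->
    dominates idfun Q R -> dominates idfun Q R' -> forall x, R x <-> R' x.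

(* Integral separated schemes of finite type over k. *)
Record variety (k : fieldType) := Variety {
  prevariety_of :> prevariety k;
  variety_separated : separated prevariety_of
}.

Definition regular_at (k : fieldType) (X Y : prevariety k)
    (f : funfield Y -> funfield X) (R : funfield X -> Prop) :=
  exists S : funfield Y -> Prop, point S /\ dominates f R S.

(* Dominant rational maps from X to Y. *)
Record rat_map (k : fieldType) (X Y : prevariety k) := RatMap {
  pullback : {rmorphism funfield Y -> funfield X};
  pullback_const : forall a, pullback (const Y a) = const X a;
  pullback_defined : exists U : (funfield X -> Prop) -> Prop,
    [/\ zariski_open U, exists R, U R
      & forall R, U R -> regular_at pullback R]
}.

Definition regular (k : fieldType) (X Y : prevariety k) (f : rat_map X Y) :=
  forall R, point R -> regular_at (pullback f) R.

(* The group of birational automorphisms. Composition reverses pullbacks. *)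
Record Bir (k : fieldType) (X : prevariety k) := BirMap {
  bir_map :> rat_map X X;
  bir_inv : exists g : rat_map X X,
    cancel (pullback bir_map) (pullback g) /\
    cancel (pullback g) (pullback bir_map)
}.

(* Injective homomorphisms from G to Bir(X). *)
Definition Bir_embedding (k : fieldType) (X : prevariety k)
    (gT : finGroupType) (G : {group gT}) (f : gT -> Bir X) :=
  (forall g h, g \in G -> h \in G ->
     pullback (f (g * h)%g) =1 pullback (f h) \o pullback (f g)) /\
  (forall g h, g \in G -> h \in G ->
     pullback (f g) =1 pullback (f h) -> g = h).

Section Generation.
Variables (k K : fieldType) (c : {rmorphism k -> K}) (L : seq K).
Local Notation A := (adjoin c L).

Let quot x := exists a b, [/\ A a, A b, b != 0 & x = a / b].

Lemma adjoin1 : A 1. Proof. by rewrite -(rmorph1 c); exact: adjoin_const. Qed.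

Lemma adjoinN x : A x -> A (- x).
Proof.
by move=> Ax; rewrite -mulN1r -(rmorph1 c) -rmorphN;
   apply: adjoin_mul => //; exact: adjoin_const.
Qed.

Lemma quot_adjoin x : A x -> quot x.
Proof. by move=> Ax; exists x, 1; rewrite oner_eq0 divr1; split=> //; exact: adjoin1. Qed.

Lemma quotD x y : quot x -> quot y -> quot (x + y).
Proof.
move=> [a [b [Aa Ab b0 ->]]] [a' [b' [Aa' Ab' b'0 ->]]].
exists (a * b' + a' * b), (b * b'); split.
- by apply: adjoin_add; apply: adjoin_mul.
- exact: adjoin_mul.
- by rewrite mulf_neq0.
- by rewrite addf_div.
Qed.

Lemma quotM x y : quot x -> quot y -> quot (x * y).
Proof.
move=> [a [b [Aa Ab b0 ->]]] [a' [b' [Aa' Ab' b'0 ->]]].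
exists (a * a'), (b * b'); split; rewrite ?mulf_neq0 ?mulf_div //;
  exact: adjoin_mul.
Qed.

Lemma quotV x : quot x -> quot x^-1.
Proof.
move=> [a [b [Aa Ab b0 ->]]]; have [->|a0] := eqVneq a 0.
  by rewrite mul0r invr0; apply: quot_adjoin; rewrite -(rmorph0 c);
     exact: adjoin_const.
by exists b, a; rewrite invf_div.
Qed.

End Generation.

Local Notation "x %:F" := (@FracField.tofrac _ x) : ring_scope.

Lemma fraction_repr (D : idomainType) (x : {fraction D}) :
  exists a b : D, b != 0 /\ x = a%:F / b%:F.
Proof.
elim/quotW: x => r; exists \n_r, \d_r; split; first exact: denom_ratioP.
apply: (canRL (mulfK _)); first by rewrite tofrac_eq0 denom_ratioP.
rewrite -[LHS]/(FracField.mul _ _) !piE; apply/eqmodP => /=.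
rewrite FracField.equivfE /FracField.mulf !numden_Ratio ?mulr1 ?oner_eq0 //;
  rewrite ?denom_ratioP //.
by rewrite mulrC.
Qed.

Section AffineSpace.
Variables (k : fieldType) (m : nat).
Local Notation D := {mpoly k[m]}.
Local Notation K := {fraction D}.

Definition affine_const : {rmorphism k -> K} :=
  (@FracField.tofrac D) \o (@mpolyC m k).

Definition coordinates : seq K := [seq ('X_i : D)%:F | i <- enum 'I_m].

Lemma coordinates_gen : generates affine_const coordinates.
Proof.
have pA (p : D) : adjoin affine_const coordinates p%:F.
  elim/mpolyind: p => [|a M p _ _ IH].
    by rewrite rmorph0 -(rmorph0 affine_const); exact: adjoin_const.
  rewrite rmorphD; apply: adjoin_add => //.
  rewrite -mul_mpolyC rmorphM; apply: adjoin_mul; first exact: adjoin_const.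
  rewrite mpolyXE_id rmorph_prod /=.
  elim/big_ind: _ => [|x y Ax Ay|i _]; [exact: adjoin1|exact: adjoin_mul|].
  rewrite rmorphXn; elim: (M i) => [|e IHe]; first exact: adjoin1.
  rewrite exprS; apply: adjoin_mul => //; apply: adjoin_gen.
  by apply: map_f; rewrite mem_enum.
move=> x; have [a [b [b0 ->]]] := fraction_repr x.
by exists a%:F, b%:F; rewrite tofrac_eq0.
Qed.

Lemma affine_charts_gen L :
  L \in [:: coordinates] -> generates affine_const L.
Proof. by rewrite inE => /eqP ->; exact: coordinates_gen. Qed.

Definition affine_prevariety : prevariety k :=
  @Prevariety k K affine_const [:: coordinates] isT affine_charts_gen.

End AffineSpace.

Lemma affine_separated (k : fieldType) (X : prevariety k) L :
  charts X = [:: L] -> separated X.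
Proof.
move=> XL.
suff key (R R' Q : funfield X -> Prop) : point R -> point R' ->
    dominates idfun Q R -> dominates idfun Q R' -> forall x, R x -> R' x.
  by move=> R R' Q pR pR' _ d d' x; split; [exact: (key R R' Q)|exact: (key R' R Q)].
move=> [L1 [P [+ [PA [P0 _] PM P1 Pp] RE]]] [L2 [P' [+ [PA' [P0' _] PM' P1' Pp'] RE']]].
rewrite XL !inE => /eqP ? /eqP ?; subst L1 L2 => -[RQ RQV] [RQ' RQV'] x.
set A := adjoin _ _ in PA PM Pp PA' PM' Pp' RE RE'.
have A1 : A 1 by exact: adjoin1.
have AR' a : A a -> R' a by move=> Aa; apply/RE'; exists a, 1; rewrite divr1.
move=> /RE[a [b [Aa Ab Pb ->]]]; apply/RE'; exists a, b; split=> // Pb'.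
have Qb : Q b^-1.
  by apply: RQ; apply/RE; exists 1, b; rewrite mul1r.
have /RE'[u [v [Au Av Pv]]] : R' b^-1 by apply: RQV' => //; exact: AR'.
have v0 : v != 0 by apply/eqP => v0; apply: Pv; rewrite v0.
have b0 : b != 0 by apply/eqP => b0; apply: Pb; rewrite b0.
move=> /eqP; rewrite -[b^-1]mul1r eqr_div // mul1r => /eqP vE.
by apply: Pv; rewrite vE; exact: PM'.
Qed.

(* The affine space of column vectors of size m. *)
Definition affine_space (k : fieldType) (m : nat) : variety k :=
  @Variety k (affine_prevariety k m) 
    (@affine_separated k (affine_prevariety k m) (coordinates k m) erefl).

Definition coord (k : fieldType) (m : nat) (i : 'I_m) :
    funfield (affine_space k m) :=
  ('X_i : {mpoly k[m]})%:F.

Section TimesP1.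
Variables (k : fieldType) (X : prevariety k).
Local Notation K := (funfield X).
Local Notation Kt := {fraction {poly K}}.

Definition lift_fun : {rmorphism K -> Kt} :=
  (@FracField.tofrac {poly K}) \o (@polyC K).

Definition P1_coord : Kt := ('X : {poly K})%:F.

Definition timesP1_const : {rmorphism k -> Kt} := lift_fun \o const X.

Definition timesP1_charts : seq (seq Kt) :=
  [seq P1_coord :: map lift_fun L | L <- charts X] ++
  [seq P1_coord^-1 :: map lift_fun L | L <- charts X].

Lemma timesP1_charts_neq0 : timesP1_charts != [::].
Proof. by rewrite /timesP1_charts; case: (charts X) (charts_neq0 X). Qed.

Lemma timesP1_generates t L : t \in [:: P1_coord; P1_coord^-1] ->
  generates (const X) L -> generates timesP1_const (t :: map lift_fun L).
Proof.
move=> tE genL x; set M := _ :: _.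
have AM a : adjoin (const X) L a -> adjoin timesP1_const M (lift_fun a).
  elim=> [c|y yL|y z _ Ay _ Az|y z _ Ay _ Az].
  - exact: adjoin_const.
  - by apply: adjoin_gen; rewrite inE map_f ?orbT.
  - by rewrite rmorphD; exact: adjoin_add.
  - by rewrite rmorphM; exact: adjoin_mul.
have Qt : exists a b, [/\ adjoin timesP1_const M a, adjoin timesP1_const M b,
    b != 0 & P1_coord = a / b].
  have : adjoin timesP1_const M t by apply: adjoin_gen; rewrite mem_head.
  move/quot_adjoin; move: tE; rewrite !inE => /orP[] /eqP -> //.
  by move/quotV; rewrite invrK.
have Qp (p : {poly K}) : exists a b, [/\ adjoin timesP1_const M a,
    adjoin timesP1_const M b, b != 0 & p%:F = a / b].
  elim/poly_ind: p => [|p c IH].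
    by apply: quot_adjoin; rewrite rmorph0 -(rmorph0 timesP1_const);
       exact: adjoin_const.
  rewrite rmorphD rmorphM; apply: quotD; first exact: quotM.
  have [a [b [Aa Ab b0 ->]]] := genL c.
  exists (lift_fun a), (lift_fun b); split; rewrite ?fmorph_eq0 //; try exact: AM.
  exact: (fmorph_div lift_fun).
have [a [b [b0 ->]]] := fraction_repr x.
by apply: quotM; last apply: quotV; exact: Qp.
Qed.

Lemma timesP1_charts_gen M : M \in timesP1_charts -> generates timesP1_const M.
Proof.
by rewrite mem_cat => /orP[] /mapP[L LX ->]; apply: timesP1_generates;
   rewrite ?inE ?eqxx ?orbT //; exact: charts_gen.
Qed.

(* The product of X with the projective line. *)
Definition timesP1 : prevariety k :=
  @Prevariety k Kt timesP1_const timesP1_charts timesP1_charts_neq0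
    timesP1_charts_gen.

End TimesP1.

(* Dominance of the rational map (u, v) : Z --> X x Y with pullbacks f and g: no
   nonzero element \sum_i x_i (x) y_i of k(X) (x)_k k(Y) restricts to zero on Z.
   One may take the x_i linearly independent; the element is then zero if and
   only if all the y_i are zero. *)
Definition jointly_dominant (k : fieldType) (X Y : prevariety k)
    (L : fieldType) (f : funfield X -> L) (g : funfield Y -> L) :=
  forall m (x : 'I_m -> funfield X) (y : 'I_m -> funfield Y),
    lin_independent x -> \sum_i f (x i) * g (y i) = 0 -> forall i, y i = 0.

(* X is rationally connected: there is a family u : T x P^1 --> X of rational
   curves such that T x P^1 x P^1 --> X x X, (t, a, b) |-> (u(t, a), u(t, b)), is
   dominant (Kollar, Rational curves on algebraic varieties, IV.3, in its
   birationally invariant form). Here p and q are the projections (t, a, b) |->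
   (t, a) and (t, a, b) |-> (t, b). Dominance forces X to be geometrically
   irreducible. *)
Definition rationally_connected (k : fieldType) (X : variety k) :=
  exists (T : variety k) (u : rat_map (timesP1 T) X)
         (p q : rat_map (timesP1 (timesP1 T)) (timesP1 T)),
  [/\ forall x, pullback p (lift_fun T x) =
                  lift_fun (timesP1 T) (lift_fun T x)
        /\ pullback q (lift_fun T x) = lift_fun (timesP1 T) (lift_fun T x),
      pullback p (P1_coord T) = lift_fun (timesP1 T) (P1_coord T),
      pullback q (P1_coord T) = P1_coord (timesP1 T)
    & jointly_dominant (X := X) (Y := X) (pullback p \o pullback u)
        (pullback q \o pullback u)].

(* j is an admissible value of the Jordan constant j(n) over k. *)
Definition is_jordan_constant (k : fieldType) (n j : nat) :=
  (0 < j)%N /\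
  forall (X : variety k), has_dim X n -> rationally_connected X ->
  forall (gT : finGroupType) (G : {group gT}) (f : gT -> Bir X),
    Bir_embedding G f ->
  exists A : {group gT}, [/\ (A <| G)%g, abelian A & (#|G : A|%g <= j)%N].

Section EssentialDimension.
Variables (k : fieldType) (gT : finGroupType) (G : {group gT}).

Definition is_action (X : variety k) (f : gT -> rat_map X X) :=
  [/\ forall g, g \in G -> regular (f g),
      pullback (f 1%g) =1 id
    & forall g h, g \in G -> h \in G ->
        pullback (f (g * h)%g) =1 pullback (f h) \o pullback (f g)].

Definition is_faithful (X : variety k) (f : gT -> rat_map X X) :=
  forall g, g \in G -> pullback (f g) =1 id -> g = 1%g.

(* G acts on column vectors by v |-> rG g *m v. *)
Definition is_linear_action m (rG : mx_representation k G m)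
    (f : gT -> rat_map (affine_space k m) (affine_space k m)) :=
  is_action f /\
  forall g i, g \in G -> pullback (f g) (coord k i) =
    \sum_j const (affine_space k m) (rG g i j) * coord k j.

Definition linearizable (X : variety k) (f : gT -> rat_map X X) :=
  exists m (rG : mx_representation k G m)
    (a : gT -> rat_map (affine_space k m) (affine_space k m))
    (phi : rat_map (affine_space k m) X),
  is_linear_action rG a /\
  forall g, g \in G ->
    pullback (a g) \o pullback phi =1 pullback phi \o pullback (f g).

Definition faithful_linearizable (X : variety k) (f : gT -> rat_map X X) :=
  [/\ is_action f, is_faithful f & linearizable f].

(* ed_k(G) = d. *)
Definition is_ed d :=
  (exists (X : variety k) (f : gT -> rat_map X X),
     faithful_linearizable f /\ has_dim X d) /\
  (forall (X : variety k) (f : gT -> rat_map X X) d',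
     faithful_linearizable f -> has_dim X d' -> (d <= d')%N).

(* rdim_k(G) = r. *)
Definition is_rdim r :=
  [/\ (0 < r)%N,
      exists rG : mx_representation k G r, mx_faithful rG
    & forall r' (rG : mx_representation k G r'),
        (0 < r')%N -> mx_faithful rG -> (r <= r')%N].

End EssentialDimension.

Section GmWreath.
Variables (k : fieldType) (r : nat).

Definition torus : predArgType :=
  {t : {ffun 'I_r -> k} | [forall i, t i != 0]}.

Definition Torus (t : {ffun 'I_r -> k}) (t_neq0 : [forall i, t i != 0]) : torus :=
  exist _ t t_neq0.

(* As permutations compose from left to right, (t, s) |-> t \o s is a left
   action of the symmetric group. *)
Definition Gm_wreath : Type := (torus * 'S_r)%type.
HB.instance Definition _ := Choice.on Gm_wreath.

Implicit Types x y : Gm_wreath.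

Lemma torus_neq0 (t : torus) i : val t i != 0.
Proof. by case: t => t /= /forallP. Qed.

Fact Gmw_mul_subproof x y :
  [forall i, [ffun i => val x.1 i * val y.1 (x.2 i)] i != 0].
Proof. by apply/forallP => i; rewrite ffunE mulf_neq0 ?torus_neq0. Qed.

Fact Gmw_one_subproof : [forall i : 'I_r, [ffun=> 1 : k] i != 0].
Proof. by apply/forallP => i; rewrite ffunE oner_eq0. Qed.

Fact Gmw_inv_subproof x :
  [forall i, [ffun i => (val x.1 ((x.2^-1)%g i))^-1] i != 0].
Proof. by apply/forallP => i; rewrite ffunE invr_eq0 torus_neq0. Qed.

Definition Gmw_mul x y : Gm_wreath :=
  (Torus (Gmw_mul_subproof x y), (x.2 * y.2)%g).
Definition Gmw_one : Gm_wreath := (Torus Gmw_one_subproof, 1%g).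
Definition Gmw_inv x : Gm_wreath :=
  (Torus (Gmw_inv_subproof x), (x.2^-1)%g).

Lemma Gmw_eq x y : (forall i, val x.1 i = val y.1 i) -> x.2 = y.2 -> x = y.
Proof.
case: x y => [t s] [t' s'] /= tE ->; congr (_, _).
by apply: val_inj; apply/ffunP.
Qed.

Lemma Gmw_mulA : associative Gmw_mul.
Proof.
move=> x y z; apply: Gmw_eq => [i|] /=; last by rewrite mulgA.
by rewrite !ffunE /= permM mulrA.
Qed.

Lemma Gmw_mul1 : left_id Gmw_one Gmw_mul.
Proof.
move=> x; apply: Gmw_eq => [i|] /=; last by rewrite mul1g.
by rewrite !ffunE perm1 mul1r.
Qed.

Lemma Gmw_mulr1 : right_id Gmw_one Gmw_mul.
Proof.
move=> x; apply: Gmw_eq => [i|] /=; last by rewrite mulg1.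
by rewrite !ffunE mulr1.
Qed.

Lemma Gmw_mulV : left_inverse Gmw_one Gmw_inv Gmw_mul.
Proof.
move=> x; apply: Gmw_eq => [i|] /=; last by rewrite mulVg.
by rewrite !ffunE mulVf ?torus_neq0.
Qed.

Lemma Gmw_mulrV : right_inverse Gmw_one Gmw_inv Gmw_mul.
Proof.
move=> x; apply: Gmw_eq => [i|] /=; last by rewrite mulgV.
by rewrite !ffunE permK mulfV ?torus_neq0.
Qed.

HB.instance Definition _ := isGroup.Build Gm_wreath
  Gmw_mulA Gmw_mul1 Gmw_mulr1 Gmw_mulV Gmw_mulrV.

End GmWreath.

(* Main.v *)
Require Import Defs.
From HB Require Import structures.
From mathcomp Require Import all_boot all_order all_algebra.
From mathcomp Require Import all_fingroup all_solvable all_character.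
From mathcomp Require Import mpoly ring.
From Stdlib Require Import ClassicalEpsilon.

Set Implicit Arguments.
Unset Strict Implicit.
Unset Printing Implicit Defensive.

Import GRing.Theory.

(* Let X be a faithful linearizable G-variety of dimension d <= n, with
   k(X) inside k(V). Adding n - d variables with trivial action gives a
   unirational, hence rationally connected, variety of dimension n on which G
   acts birationally, so G has a normal abelian subgroup A with [G : A] <= j.
   Diagonalise A on V and restrict to k(X) the valuation of k(V) given by a
   monomial order: A acts on leading monomials by characters, and these
   characters depend only on the value. The group of values of k(X) has rank at
   most d by Abhyankar's inequality, and its characters separate the elements
   of A, so that A has a faithful sum of at most n characters. The
   representation of G induced from it is faithful, monomial, and of dimension
   at most n j. *)

Local Open Scope ring_scope.
Local Open Scope quotient_scope.
Local Notation "x %:F" := (@FracField.tofrac _ x) : ring_scope.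

(** * Fields of fractions *)

(** The Jordan bound speaks of dimension exactly n, and this is the reason for the extra variables.
    The characters of A are sought on the original X, of dimension d, and their list is then padded
    with trivial ones up to n.

    Only birational data matter: every inclusion of function fields over k is the pullback of a
    rational map, so charts and separatedness appear only where a model is built.

    The obstacle in the abelian step is that no smooth A-fixed point of X, whose tangent space would
    be a faithful representation, is at hand. The values of k(X) take over the role of the cotangent
    space: they form a lattice of monomial exponents, on which the leading monomials of an
    A-eigenbasis of V give characters. That these separate A rests on characteristic 0: an element
    of finite order that fixes all leading terms behaves like a unipotent element and is trivial. *)

Section FractionLift.
Variables (D : idomainType) (L : fieldType) (f : {rmorphism D -> L}).
Hypothesis inj_f : injective f.

Let num_den (x : {fraction D}) :
  {ab : D * D | ab.2 != 0 /\ x = ab.1%:F / ab.2%:F}.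
Proof.
apply: constructive_indefinite_description.
by have [a [b ab]] := fraction_repr x; exists (a, b).
Qed.

Let lift x : L := f (sval (num_den x)).1 / f (sval (num_den x)).2.

Let f_neq0 a : a != 0 -> f a != 0.
Proof. by rewrite -(rmorph0 f) (inj_eq inj_f). Qed.

Let liftE a b : b != 0 -> lift (a%:F / b%:F) = f a / f b.
Proof.
move=> b0; rewrite /lift; case: num_den => -[c d] /= [d0 /eqP].
rewrite eqr_div ?tofrac_eq0 // -!rmorphM tofrac_eq => /eqP adcb.
by apply/eqP; rewrite eqr_div ?f_neq0 // -!rmorphM adcb.
Qed.

Lemma fraction_lift :
  exists g : {rmorphism {fraction D} -> L}, forall x, g x%:F = f x.
Proof.
have lift_frac x : lift x%:F = f x.
  by rewrite -[x%:F]divr1 -(rmorph1 (@FracField.tofrac D)) liftE ?oner_eq0 //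
    rmorph1 divr1.
have lB : zmod_morphism lift.
  move=> x y; have [a [b [b0 ->]]] := fraction_repr x.
  have [c [d [d0 ->]]] := fraction_repr y.
  rewrite -mulNr addf_div ?tofrac_eq0 // -rmorphN -!rmorphM -rmorphD.
  rewrite !liftE ?mulf_neq0 // !rmorphM rmorphD !rmorphM rmorphN.
  by rewrite -addf_div ?f_neq0 // mulNr.
have lM : monoid_morphism lift.
  split=> [|x y]; first by rewrite -(rmorph1 (@FracField.tofrac D)) lift_frac
    rmorph1.
  have [a [b [b0 ->]]] := fraction_repr x.
  have [c [d [d0 ->]]] := fraction_repr y.
  by rewrite mulf_div -!rmorphM !liftE ?mulf_neq0 // !rmorphM mulf_div.
pose aM := GRing.isZmodMorphism.Build _ _ lift lB.
pose mM := GRing.isMonoidMorphism.Build _ _ lift lM.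
pose g : {rmorphism {fraction D} -> L} := HB.pack lift aM mM.
by exists g.
Qed.

End FractionLift.

Lemma eq_fraction_morph (D : idomainType) (L : fieldType)
    (g h : {rmorphism {fraction D} -> L}) :
  (forall x, g x%:F = h x%:F) -> g =1 h.
Proof.
move=> gh x; have [a [b [_ ->]]] := fraction_repr x.
by rewrite !fmorph_div !gh.
Qed.

Lemma common_denominator (K : fieldType) (A : K -> Prop) (A1 : A 1)
    (AM : forall x y, A x -> A y -> A (x * y)) m (q : 'I_m -> K) :
  (forall i, exists a b, [/\ A a, A b, b != 0 & q i = a / b]) ->
  exists b (a : 'I_m -> K), [/\ A b, b != 0 & forall i, A (a i) /\ q i = a i /
    b].
Proof.
move=> /fin_all_exists[a /fin_all_exists[b ab]].
have AP P : A (\prod_(l | P l) b l).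
  by elim/big_ind: _ => // l _; have [] := ab l.
have P0 P : \prod_(l | P l) b l != 0.
  by apply/prodf_neq0 => l _; have [] := ab l.
exists (\prod_l b l), (fun i => a i * \prod_(l | l != i) b l); split=> // i.
have [Aa Ab b0 ->] := ab i; split; first exact: AM.
set P := \prod_(_ | _) _; have -> : \prod_l b l = b i * P by rewrite (bigD1 i).
by rewrite invfM mulrACA divff ?mulr1 // P0.
Qed.

Lemma fraction_common_denominator (D : idomainType) m (q : 'I_m -> {fraction
  D}) :
  exists2 b : D, b != 0 & exists a : 'I_m -> D, forall i, q i = (a i)%:F / b%:F.
Proof.
have [|x y [a ->] [b ->]|i|_ [a [[b ->] b0 qE]]] :=
    @common_denominator _ (fun x : {fraction D} => exists a : D, x = a%:F) _ _
      m q.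
- by exists 1; rewrite rmorph1.
- by exists (a * b); rewrite rmorphM.
- have [a [b [b0 ->]]] := fraction_repr (q i).
  by exists a%:F, b%:F; split; rewrite ?tofrac_eq0 //; [exists a|exists b].
exists b; first by rewrite -tofrac_eq0.
have /fin_all_exists[a' a'E] i : exists a', q i = a'%:F / b%:F.
  by have [[a' aE] ->] := qE i; exists a'; rewrite aE.
by exists a'.
Qed.

Lemma fraction_poly_lift (K L : fieldType) (s : {rmorphism K -> L}) (t : L) :
  (forall p : {poly K}, (map_poly s p).[t] = 0 -> p = 0) ->
  exists g : {rmorphism {fraction {poly K}} -> L},
    g ('X)%:F = t /\ forall a, g (a%:P)%:F = s a.
Proof.
move=> tr; have cst : commr_rmorph s t by move=> x; exact: mulrC.
pose f : {rmorphism {poly K} -> L} := horner_morph cst.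
have fE p : f p = (map_poly s p).[t] by [].
have inj_f : injective f.
  by move=> p q /eqP; rewrite -subr_eq0 -rmorphB => /eqP /tr /eqP;
    rewrite subr_eq0 => /eqP.
have [g gE] := fraction_lift inj_f; exists g.
by rewrite gE fE map_polyX hornerX; split=> // a;
  rewrite gE fE map_polyC hornerC.
Qed.

Lemma mmap_comp (n : nat) (R S T : comNzRingType) (c : {rmorphism R -> S})
  (h : 'I_n -> S) (f : {rmorphism S -> T}) (p : {mpoly R[n]}) :
  f (mmap c h p) = mmap (f \o c) (f \o h) p.
Proof.
rewrite /mmap rmorph_sum; apply: eq_bigr => m _ /=.
by rewrite rmorphM /mmap1 rmorph_prod; congr (_ * _); apply: eq_bigr => i _;
   rewrite rmorphXn.
Qed.

Lemma fraction_mpoly_lift n (k L : fieldType) (c : {rmorphism k -> L})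
    (x : 'I_n -> L) :
  (forall p : {mpoly k[n]}, mmap c x p = 0 -> p = 0) ->
  exists g : {rmorphism {fraction {mpoly k[n]}} -> L},
    forall p : {mpoly k[n]}, g p%:F = mmap c x p.
Proof.
move=> ind; have inj_f : injective (mmap c x).
  by move=> p q /eqP; rewrite -subr_eq0 -rmorphB => /eqP /ind /eqP;
    rewrite subr_eq0 => /eqP.
exact: (fraction_lift inj_f).
Qed.

(** * Morphisms of function fields and rational maps *)

Section Localization.
Variables (k : fieldType) (X : prevariety k) (A P : funfield X -> Prop).
Hypothesis A1 : A 1.
Hypothesis AD : forall x y, A x -> A y -> A (x + y).
Hypothesis AM : forall x y, A x -> A y -> A (x * y).
Hypothesis primeP : prime_ideal A P.

Lemma prime_notin_neq0 x : ~ P x -> x != 0.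
Proof. by case: primeP => _ [P0 _] _ _ _ Px; apply/eqP => x0; apply: Px;
  rewrite x0. Qed.

Lemma prime_notinM x y : A x -> A y -> ~ P x -> ~ P y -> ~ P (x * y).
Proof. by case: primeP => _ _ _ _ Pp Ax Ay Px Py /Pp []. Qed.

Lemma localization_sub x : A x -> localization A P x.
Proof. by move=> Ax; exists x, 1; case: primeP => _ _ _ P1 _;
  rewrite divr1. Qed.

Lemma localizationD x y :
  localization A P x -> localization A P y -> localization A P (x + y).
Proof.
move=> [a [b [Aa Ab Pb ->]]] [c [d [Ac Ad Pd ->]]].
exists (a * d + c * b), (b * d); split; auto; first exact: prime_notinM.
by rewrite addf_div ?prime_notin_neq0.
Qed.

Lemma localizationM x y :
  localization A P x -> localization A P y -> localization A P (x * y).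
Proof.
move=> [a [b [Aa Ab Pb ->]]] [c [d [Ac Ad Pd ->]]].
exists (a * c), (b * d); split; auto; first exact: prime_notinM.
by rewrite mulf_div.
Qed.

End Localization.

Section Contraction.
Variables (k : fieldType) (X Y : prevariety k).
Variable f : {rmorphism funfield Y -> funfield X}.
Hypothesis fC : forall a, f (const Y a) = const X a.

(** The point of [Y] below [R] is the contraction of the maximal ideal of [R] to the chart k[L]. It
    is named [Q] in the proof, and the localization of the chart at [Q] is dominated by [R]. *)
Lemma regular_at_chart (R : funfield X -> Prop) L :
  L \in charts Y -> point R -> (forall y, y \in L -> R (f y)) -> regular_at f R.
Proof.
move=> LY [L0 [P [L0X primeP RE]]] RL.
set A := adjoin (const X) L0 in primeP RE; set B := adjoin (const Y) L.
have A1 : A 1 by exact: adjoin1.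
have AD x y : A x -> A y -> A (x + y) by exact: adjoin_add.
have AM x y : A x -> A y -> A (x * y) by exact: adjoin_mul.
have [PA [P0 PD] PM P1 Pp] := primeP.
have RB y : B y -> exists a b, [/\ A a, A b, ~ P b & f y = a / b].
  elim=> [a|z /RL /RE //|z w _ + _|z w _ + _].
  - by rewrite fC; apply: localization_sub => //; exact: adjoin_const.
  - by rewrite rmorphD; exact: localizationD.
  - by rewrite rmorphM; exact: localizationM.
pose Q y := B y /\ exists a b, [/\ P a, A b, ~ P b & f y = a / b].
(* Membership in [Q] can be tested on any fraction representing [f y]. *)
have QE y a b : B y -> A a -> A b -> ~ P b -> f y = a / b -> (Q y <-> P a).
  move=> By Aa Ab Pb yE; split=> [[_ [c [d [Pc Ad Pd]]]]|Pa]; last first.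
    by split=> //; exists a, b.
  move/eqP; rewrite yE eqr_div ?(prime_notin_neq0 primeP) // => /eqP adcb.
  by have [] // : P a \/ P d by apply: Pp => //; rewrite adcb mulrC; apply: PM.
have primeQ : prime_ideal B Q.
  split=> [y []//||a y Ba Qy||a b Ba Bb].
  - split; first split.
    + by rewrite -(rmorph0 (const Y)); exact: adjoin_const.
    + by exists 0, 1; rewrite rmorph0 mul0r.
    move=> y z [By [a [b [Pa Ab Pb yE]]]] [Bz [c [d [Pc Ad Pd zE]]]].
    split; first exact: adjoin_add.
    exists (a * d + c * b), (b * d); split; auto.
    + by apply: PD; rewrite mulrC; apply: PM => //; exact: PA.
    + exact: (prime_notinM primeP).
    by rewrite rmorphD yE zE addf_div ?(prime_notin_neq0 primeP).
  - have [By [c [d [Pc Ad Pd yE]]]] := Qy;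
    have [u [v [Au Av Pv aE]]] := RB _ Ba.
    split; first exact: adjoin_mul.
    exists (u * c), (v * d); split; auto.
      exact: (prime_notinM primeP).
    by rewrite rmorphM aE yE mulf_div.
  - move=> /(QE 1 1 1)-/(_ (adjoin1 _ _) A1 A1 P1) Q1; apply/P1/Q1.
    by rewrite rmorph1 divr1.
  have [u [v [Au Av Pv aE]]] := RB _ Ba; have [w [z [Aw Az Pz bE]]] := RB _ Bb.
  rewrite (QE _ _ _ Ba Au Av Pv aE) (QE _ _ _ Bb Aw Az Pz bE).
  rewrite (QE _ (u * w) (v * z)); auto; first exact: adjoin_mul.
    exact: (prime_notinM primeP).
  by rewrite rmorphM aE bE mulf_div.
exists (localization B Q); split; first by exists L, Q.
split=> _ [a [b [Ba Bb Qb ->]]].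
  have [u [v [Au Av Pv aE]]] := RB _ Ba; have [w [z [Aw Az Pz bE]]] := RB _ Bb.
  apply/RE; exists (u * z), (v * w); split; auto.
    by apply: (prime_notinM primeP) => // Pw; apply: Qb; apply/(QE _ w z).
  by rewrite fmorph_div aE bE invf_div mulf_div.
move=> /RE[c [d [Ac Ad Pd fE]]].
(* If [a] is in [Q] and nonzero, writing the inverse of [f (a / b)] as [c / d] puts [w * v * d] into
   [P], although none of its factors is there. *)
have [Qa|Qa] := classic (Q a); last by exists b, a; rewrite invf_div.
have [_ [u [v [Pu Av Pv aE]]]] := Qa; have [w [z [Aw Az Pz bE]]] := RB _ Bb.
have [a0|a0] := eqVneq a 0.
  rewrite a0 mul0r invr0; apply: localization_sub => //; first exact: adjoin1.
  by rewrite -(rmorph0 (const Y)); exact: adjoin_const.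
have u0 : u != 0.
  by apply: contra_neq a0 => u0; apply: (fmorph_inj f);
    rewrite aE u0 mul0r rmorph0.
have Pw : ~ P w by move=> Pw; apply: Qb; apply/(QE _ w z).
case: (prime_notinM primeP _ _ (prime_notinM primeP Aw Av Pw Pv) Pd); auto.
have /eqP := fE; rewrite fmorph_div aE bE invf_div mulf_div invf_div [w *
  v]mulrC.
rewrite eqr_div ?mulf_neq0 ?u0 ?(prime_notin_neq0 primeP) // => /eqP ->.
by rewrite mulrCA mulrC; apply: (PM) => //; exact: AM.
Qed.

End Contraction.

Lemma chart_exists (k : fieldType) (X : prevariety k) : exists L, L \in charts
  X.
Proof.
by case: (charts X) (charts_neq0 X) => // L s _; exists L; rewrite mem_head.
Qed.

Lemma generic_point (k : fieldType) (X : prevariety k) :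
  point (X := X) (fun=> True).
Proof.
have [L LX] := chart_exists X.
exists L, (eq 0); split=> //; last first.
  move=> x; split=> // _; have [a [b [Aa Ab b0 ->]]] := charts_gen LX x.
  by exists a, b; split=> // /esym/eqP; apply/negP.
split=> [_ <-||a _ _ <-||a b _ _ /esym/eqP].
- by rewrite -(rmorph0 (const X)); exact: adjoin_const.
- by split=> // _ _ <- <-; rewrite addr0.
- by rewrite mulr0.
- by move/esym/eqP; rewrite oner_eq0.
by rewrite mulf_eq0 => /orP[] /eqP ->; [left|right].
Qed.

(** The domain is the locus where the pullbacks of the generators of one chart of [Y] are regular.
    It is open because they are finitely many, and it contains the generic point. *)
Lemma morph_rat_map (k : fieldType) (X Y : prevariety k)
    (f : {rmorphism funfield Y -> funfield X}) :
  (forall a, f (const Y a) = const X a) ->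
  exists u : rat_map X Y, pullback u = f.
Proof.
move=> fC; have [L LY] := chart_exists Y.
suff fU : exists U : (funfield X -> Prop) -> Prop, [/\ zariski_open U,
    exists R, U R & forall R, U R -> regular_at f R] by exists (RatMap fC fU).
exists (fun R => point R /\ forall y, y \in L -> R (f y)); split.
- split=> [R []//|R [pR RL]]; exists [seq f y | y <- L]; split.
    by move=> _ /mapP[y yL ->]; exact: RL.
  by move=> R' pR' R'L; split=> // y yL; apply: R'L; exact: map_f.
- by exists (fun=> True); split=> //; exact: generic_point.
- by move=> R [pR RL]; exact: (regular_at_chart fC LY).
Qed.

Section AffineModel.
Variables (k K : fieldType) (c : {rmorphism k -> K}) (L : seq K).
Hypothesis genL : generates c L.

Let gen1 M : M \in [:: L] -> generates c M.
Proof. by rewrite inE => /eqP ->. Qed.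

(** With a single chart separatedness is automatic. Keeping one chart of a prevariety therefore
    gives a variety with the same function field, hence the same dimension and the same field
    automorphisms. *)
Definition affine_model : variety k :=
  @Variety k (@Prevariety k K c [:: L] isT gen1)
    (@affine_separated k (@Prevariety k K c [:: L] isT gen1) L erefl).

End AffineModel.

(** * Algebraic dependence *)

Section Subfield.
Variables (K : fieldType) (P : K -> Prop).
Hypotheses (P1 : P 1) (PB : forall x y, P x -> P y -> P (x - y))
  (PM : forall x y, P x -> P y -> P (x * y)) (PV : forall x, P x -> P x^-1).

Let S : {pred K} := fun x => if excluded_middle_informative (P x) then true
  else false.

Let SP x : reflect (P x) (x \in S).
Proof. by rewrite unfold_in /S; case: excluded_middle_informative => Px;
  constructor. Qed.

Let S_divring : divring_closed S.
Proof.
split; first exact/SP.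
  by move=> x y /SP Px /SP Py; apply/SP; exact: PB.
by move=> x y /SP Px /SP Py; apply/SP/PM => //; exact: PV.
Qed.
HB.instance Definition _ := GRing.isDivringClosed.Build K S S_divring.

Definition subfield_of := {x | x \in S}.
HB.instance Definition _ := [isSub for (@sval K S : subfield_of -> K)].
HB.instance Definition _ := [Choice of subfield_of by <:].
HB.instance Definition _ := [SubChoice_isSubComUnitRing of subfield_of by <:].
HB.instance Definition _ := [SubComUnitRing_isSubIntegralDomain of subfield_of
  by <:].
HB.instance Definition _ := [SubIntegralDomain_isSubField of subfield_of by <:].

(** Excluded middle makes [P] boolean, so that k(L), known only as a predicate, becomes a field over
    which integrality can be stated. *)
Lemma subfield_type :
  exists (F : fieldType) (i : {rmorphism F -> K}),
    forall x, P x <-> exists y : F, i y = x.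
Proof.
exists (subfield_of : fieldType), (\val : {rmorphism _ -> _}) => x.
split=> [/SP Px|[y <-]]; first by exists (exist _ x Px).
exact/SP/valP.
Qed.

End Subfield.

Section AlgebraicDependence.
Variables (k K : fieldType) (c : {rmorphism k -> K}).
Implicit Types (L M S : seq K) (x y : K).

Definition frac_adjoin L x :=
  exists a b, [/\ adjoin c L a, adjoin c L b, b != 0 & x = a / b].

(* Clearing denominators, this says that x is algebraic over k(L). *)
Definition algdep L x :=
  exists p : {poly K}, [/\ p != 0, forall i, adjoin c L p`_i & root p x].

Lemma adjoin0 L : adjoin c L 0.
Proof. by rewrite -(rmorph0 c); exact: adjoin_const. Qed.

Lemma adjoin_sum L (I : Type) (r : seq I) (P : pred I) (F : I -> K) :
  (forall i, P i -> adjoin c L (F i)) -> adjoin c L (\sum_(i <- r | P i) F i).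
Proof. by move=> AF; elim/big_ind: _ => // *;
  [exact: adjoin0|exact: adjoin_add]. Qed.

Lemma adjoinX L x n : adjoin c L x -> adjoin c L (x ^+ n).
Proof.
by move=> Lx; elim: n => [|n IH]; [exact: adjoin1|rewrite exprS;
  exact: adjoin_mul].
Qed.

Lemma adjoin_trans L M x : (forall y, y \in L -> adjoin c M y) ->
  adjoin c L x -> adjoin c M x.
Proof.
move=> LM; elim=> [a|y yL|y z _ IHy _|y z _ IHy _].
- exact: adjoin_const.
- exact: LM.
- exact: adjoin_add.
exact: adjoin_mul.
Qed.

Lemma adjoin_subset L M x : {subset L <= M} -> adjoin c L x -> adjoin c M x.
Proof. by move=> LM; apply: adjoin_trans => y /LM; exact: adjoin_gen. Qed.

Lemma adjoin_frac L x : adjoin c L x -> frac_adjoin L x.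
Proof. exact: quot_adjoin. Qed.

Lemma algdep_frac L (p : {poly K}) x : p != 0 -> (forall i, frac_adjoin L p`_i)
  ->
  root p x -> algdep L x.
Proof.
move=> p0 Lp px.
have [b [a [Lb b0 pE]]] := common_denominator (adjoin1 c L)
  (@adjoin_mul _ _ c L) (fun i : 'I_(size p) => Lp i).
exists (b *: p); split; rewrite ?scaler_eq0 ?negb_or ?b0 //; last first.
  by rewrite rootE hornerZ (rootP px) mulr0.
move=> i; rewrite coefZ; have [lei|lti] := leqP (size p) i.
  by rewrite nth_default // mulr0; exact: adjoin0.
by have [La /= ->] := pE (Ordinal lti); rewrite mulrC divfK.
Qed.

(** Over a field, algebraic and integral elements agree; the closure properties of [algdep] are
    inherited from those of integral elements. *)
Lemma algdep_field L : exists (F : fieldType) (i : {rmorphism F -> K}),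
  (forall x, frac_adjoin L x <-> exists y : F, i y = x) /\
  (forall x, algdep L x <-> integralOver i x).
Proof.
have [||||F [i iP]] := @subfield_type K (frac_adjoin L).
- exact/adjoin_frac/adjoin1.
- move=> x y Lx [a [b [La Lb b0 ->]]]; rewrite -mulNr; apply: quotD => //.
  by exists (- a), b; split=> //; exact: adjoinN.
- exact: quotM.
- exact: quotV.
exists F, i; split=> // x; rewrite -integral_algebraic; split.
  move=> [p [p0 Lp px]].
  have /fin_all_exists[q qE] (j : 'I_(size p)) : exists y : F, i y = p`_j.
    exact/iP/adjoin_frac.
  have pE : p = map_poly i (\poly_(j < size p) odflt 0 (omap q (insub j))).
    apply/polyP => j; rewrite coef_map coef_poly; case: ltnP => [ltj|lej].
      by rewrite insubT /= qE.
    by rewrite raddf0 nth_default.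
  by rewrite pE in p0 px;
    exists (\poly_(j < size p) odflt 0 (omap q (insub j)));
    rewrite // -(map_poly_eq0 i).
move=> [p p0 px]; apply: algdep_frac px; first by rewrite map_poly_eq0.
by move=> j; apply/iP; rewrite coef_map; exists p`_j.
Qed.

Lemma algdep_adjoin L x : adjoin c L x -> algdep L x.
Proof.
move=> Lx; have [F [i [iP ->]]] := algdep_field L.
by have /iP[y <-] := adjoin_frac Lx; exact: integral_id.
Qed.

Lemma algdep_gen L x : x \in L -> algdep L x.
Proof. by move=> xL; apply/algdep_adjoin/adjoin_gen. Qed.

Lemma algdepD L x y : algdep L x -> algdep L y -> algdep L (x + y).
Proof. by have [F [i [_ iA]]] := algdep_field L; rewrite !iA;
  exact: integral_add. Qed.

Lemma algdepM L x y : algdep L x -> algdep L y -> algdep L (x * y).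
Proof. by have [F [i [_ iA]]] := algdep_field L; rewrite !iA;
  exact: integral_mul. Qed.

Lemma algdepV L x : algdep L x -> algdep L x^-1.
Proof. by have [F [i [_ iA]]] := algdep_field L; rewrite !iA;
  exact: integral_inv. Qed.

Lemma algdep_trans L M x : (forall y, y \in L -> algdep M y) ->
  algdep L x -> algdep M x.
Proof.
move=> LM [p [p0 Lp px]]; have [F [i [_ iA]]] := algdep_field M.
apply/iA; apply: integral_root p0 px _ => _ /(nthP 0)[j _ <-].
apply/iA; elim: (Lp j) => [a|y /LM //|y z _ IHy _|y z _ IHy _].
- exact/algdep_adjoin/adjoin_const.
- exact: algdepD.
exact: algdepM.
Qed.

Lemma algdep_subset L M x : {subset L <= M} -> algdep L x -> algdep M x.
Proof. by move=> LM; apply: algdep_trans => y /LM; exact: algdep_gen. Qed.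

Lemma adjoin_cons L x y : adjoin c (x :: L) y ->
  exists p : {poly K}, (forall i, adjoin c L p`_i) /\ y = p.[x].
Proof.
elim=> [a|z|z w _ [p [Lp ->]] _ [q [Lq ->]]|z w _ [p [Lp ->]] _ [q [Lq ->]]].
- exists (c a)%:P; rewrite hornerC; split=> // i; rewrite coefC.
  by case: ifP => _; [exact: adjoin_const|exact: adjoin0].
- rewrite inE => /predU1P[->|zL].
    exists 'X; rewrite hornerX; split=> // i; rewrite coefX.
    by case: eqP => _; [exact: adjoin1|exact: adjoin0].
  exists z%:P; rewrite hornerC; split=> // i; rewrite coefC.
  by case: ifP => _; [exact: adjoin_gen|exact: adjoin0].
- by exists (p + q); rewrite hornerD; split=> // i; rewrite coefD;
  exact: adjoin_add.
exists (p * q); rewrite hornerM; split=> // i; rewrite coefM.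
by apply: adjoin_sum => j _; exact: adjoin_mul.
Qed.

Lemma adjoin_horner L M (p : {poly K}) x : {subset L <= M} ->
  (forall i, adjoin c L p`_i) -> x \in M -> adjoin c M p.[x].
Proof.
move=> LM Lp xM; rewrite horner_coef; apply: adjoin_sum => i _.
apply: adjoin_mul; first exact: adjoin_subset (Lp i).
exact/adjoinX/adjoin_gen.
Qed.

Lemma algdep_exchange L x y :
  algdep (x :: L) y -> ~ algdep L y -> algdep (y :: L) x.
Proof.
move=> [p [p0 Lp py]] Ly.
have /fin_all_exists[P PE] (j : 'I_(size p)) := adjoin_cons (Lp j).
(* A two-variable polynomial U(X, Y) over k[L] with U(x, Y) = p. The relation for [x] over k[y, L]
   is then U(X, y). *)
pose U : {poly {poly K}} := \poly_(j < size p) odflt 0 (omap P (insub j)).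
have UE (j : nat) : (U`_j).[x] = p`_j /\ forall i, adjoin c L U`_j`_i.
  rewrite coef_poly; case: ltnP => [ltj|lej]; last first.
    by rewrite horner0 nth_default //; split=> // i; rewrite coef0;
      exact: adjoin0.
  by rewrite insubT /=; have [] := PE (Ordinal ltj).
have pE : p = (swapXY U).[x%:P].
  by rewrite horner_swapXY; apply/polyP => j; rewrite coef_map; have [] := UE j.
have U0 : swapXY U != 0 by apply: contra_neq p0 => U0; rewrite pE U0 horner0.
exists (U.[y%:P]); split.
(* If U(X, y) vanished, the leading coefficient of U with respect to X would be a nonzero polynomial
   over k[L] with root [y]. *)
- rewrite -[U]swapXYK horner_swapXY; apply: contra_not_neq Ly => V0.
  exists (swapXY U)`_(size (swapXY U)).-1; split.
  + by rewrite -lead_coefE lead_coef_eq0.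
  + by move=> i; rewrite coef_swapXY; have [] := UE i.
  by move/polyP/(_ (size (swapXY U)).-1): V0; rewrite coef_map coef0 => /eqP.
- move=> i; rewrite -[U]swapXYK horner_swapXY coef_map.
  apply: (@adjoin_horner L); rewrite ?mem_head //.
    by move=> z zL; rewrite inE zL orbT.
  by move=> j; rewrite coef_swapXY; have [] := UE j.
by rewrite /root -horner2_swapXY -pE.
Qed.

(** Drop elements of [S] from the left as long as [y] stays algebraic over the rest. Since [y] is
    not algebraic over [M], some element cannot be dropped; the first such one is exchanged with
    [y]. *)
Lemma algdep_exchange_seq S M y : algdep (S ++ M) y -> ~ algdep M y ->
  exists x S', [/\ {subset S <= x :: S'}, size S = (size S').+1
    & algdep (y :: S' ++ M) x].
Proof.
move=> + My; elim: S => [//|x S IH] /= xSy.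
have [/IH[z [S' [SS' -> Sz]]]|Sy] := classic (algdep (S ++ M) y); last first.
  by exists x, S; split=> //; exact: algdep_exchange.
exists z, (x :: S'); split=> //.
  move=> w; rewrite !inE => /orP[->|/SS']; first by rewrite orbT.
  by rewrite inE => /orP[]->; rewrite ?orbT.
apply: algdep_subset Sz => w; rewrite !inE /= !mem_cat.
by case: eqP => //= _ ->; rewrite orbT.
Qed.

Definition spans S := forall x, algdep S x.

Lemma spans_exchange S M y : spans (S ++ M) -> ~ algdep M y ->
  exists2 S', size S = (size S').+1 & spans (S' ++ y :: M).
Proof.
move=> SM My; have [x [S' [SS' sS xS']]] := algdep_exchange_seq (SM y) My.
exists S' => // z; apply: algdep_trans (SM z) => w; rewrite mem_cat.
have sub : {subset y :: S' ++ M <= S' ++ y :: M}.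
  by move=> v; rewrite !(inE, mem_cat); case: eqP => //= _; rewrite orbT.
case/orP=> [/SS'|wM].
  rewrite inE => /predU1P[->|wS']; first exact: algdep_subset xS'.
  by apply: algdep_gen; rewrite mem_cat wS'.
by apply: algdep_gen; rewrite mem_cat inE wM !orbT.
Qed.

End AlgebraicDependence.

(** * Polynomial evaluation, algebraic independence and dimension *)

Lemma eq_mmap n (k : nzRingType) (R : comNzRingType) (c c' : k -> R) (x y :
  'I_n -> R)
  (p : {mpoly k[n]}) : c =1 c' -> x =1 y -> mmap c x p = mmap c' y p.
Proof.
move=> cc' xy; apply: eq_bigr => m _; rewrite cc'; congr (_ * _).
by apply: eq_bigr => i _; rewrite xy.
Qed.

Lemma eq_mpoly_morph n (k R : comNzRingType)
    (f g : {rmorphism {mpoly k[n]} -> R}) :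
  (forall a, f a%:MP = g a%:MP) -> (forall i, f 'X_i = g 'X_i) -> f =1 g.
Proof.
move=> fgC fgX; elim/mpolyind => [|a M p _ _ IH]; first by rewrite !raddf0.
rewrite !raddfD /= IH; congr (_ + _); rewrite -mul_mpolyC !rmorphM fgC;
  congr (_ * _).
by rewrite mpolyXE_id !rmorph_prod; apply: eq_bigr => i _;
  rewrite !rmorphXn fgX.
Qed.

Lemma eq_poly_morph (A R : comNzRingType) (f g : {rmorphism {poly A} -> R}) :
  (forall a, f a%:P = g a%:P) -> f 'X = g 'X -> f =1 g.
Proof.
move=> fgC fgX; elim/poly_ind => [|p a IH]; first by rewrite !raddf0.
by rewrite !raddfD /= !rmorphM /= IH fgC fgX.
Qed.

Lemma mmap_var n (k : nzRingType) (R : comNzRingType) (c : {rmorphism k -> R})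
  (x : 'I_n -> R) i : mmap c x 'X_i = x i.
Proof. by rewrite mmapX mmap1U. Qed.

Lemma mmap_id n (k : comNzRingType) (p : {mpoly k[n]}) :
  mmap (@mpolyC n k) (fun i => 'X_i) p = p.
Proof.
apply: (@eq_mpoly_morph _ _ _ (mmap (@mpolyC n k) (fun i => 'X_i)) idfun) => a
  /=.
  by rewrite mmapC.
by rewrite mmap_var.
Qed.

(** Singling out the last variable allows algebraic independence to be treated one element at a
    time, as transcendence over the preceding ones. *)
Lemma mpoly_split_last (k : comNzRingType) n :
  exists (s : {rmorphism {mpoly k[n.+1]} -> {poly {mpoly k[n]}}})
         (t : {rmorphism {poly {mpoly k[n]}} -> {mpoly k[n.+1]}}),
  [/\ cancel s t, cancel t s
    & forall (R : comNzRingType) (c : {rmorphism k -> R}) (x : 'I_n.+1 -> R) q,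
      mmap c x (t q) = (map_poly (mmap c (x \o lift ord_max)) q).[x ord_max]].
Proof.
pose s : {rmorphism {mpoly k[n.+1]} -> {poly {mpoly k[n]}}} :=
  mmap (polyC \o @mpolyC n k)
    (fun i => if unlift ord_max i is Some j then ('X_j)%:P else 'X).
pose w : {rmorphism {mpoly k[n]} -> {mpoly k[n.+1]}} :=
  mmap (@mpolyC n.+1 k) (fun i => 'X_(lift ord_max i)).
have cw : commr_rmorph w 'X_ord_max by move=> x; exact: mulrC.
pose t : {rmorphism {poly {mpoly k[n]}} -> {mpoly k[n.+1]}} := horner_morph cw.
have tC a : t a%:P = w a by rewrite /t /= horner_morphC.
have tX : t 'X = 'X_ord_max by rewrite /t /= horner_morphX.
exists s, t; split.
- apply: (@eq_mpoly_morph _ _ _ (t \o s) idfun) => [a|i] /=.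
    by rewrite /s /= mmapC tC /w /= mmapC.
  rewrite /s /= mmap_var; case: unliftP => [j|] -> //.
  by rewrite tC /w /= mmap_var.
- apply: (@eq_poly_morph _ _ (s \o t) idfun) => [|/=]; last first.
    by rewrite tX /s /= mmap_var unlift_none.
  apply: (@eq_mpoly_morph _ _ _ (s \o t \o polyC) polyC) => [a|i] /=.
    by rewrite tC /w /= mmapC /s /= mmapC.
  by rewrite tC /w /= mmap_var /s /= mmap_var liftK.
move=> R c x; have cx : commr_rmorph (mmap c (x \o lift ord_max)) (x ord_max).
  by move=> y; exact: mulrC.
apply: (@eq_poly_morph _ _ (mmap c x \o t) (horner_morph cx)) => [|/=];
  last first.
  by rewrite tX mmap_var horner_morphX.
apply: (@eq_mpoly_morph _ _ _ (mmap c x \o t \o polyC) (horner_morph cx \o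
  polyC)) => [a|i] /=.
  by rewrite tC /w /= mmapC /= mmapC horner_morphC /= mmapC.
by rewrite tC /w /= mmap_var mmap_var horner_morphC /= mmap_var.
Qed.

Section Independence.
Variables (k : fieldType) (X : prevariety k).
Local Notation K := (funfield X).
Local Notation c := (const X).

Lemma adjoin_mmap m (x : 'I_m -> K) y :
  adjoin c (codom x) y <-> exists p, y = mmap c x p.
Proof.
split=> [|[p ->]].
  elim=> [a|z /codomP[i ->]|_ _ _ [p ->] _ [q ->]|_ _ _ [p ->] _ [q ->]].
  - by exists a%:MP; rewrite mmapC.
  - by exists 'X_i; rewrite mmap_var.
  - by exists (p + q); rewrite rmorphD.
  by exists (p * q); rewrite rmorphM.
apply: adjoin_sum => i _; apply: adjoin_mul; first exact: adjoin_const.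
rewrite /mmap1; elim/big_ind: _ => [|u v|j _];
  [exact: adjoin1|exact: adjoin_mul|].
by apply/adjoinX/adjoin_gen/codom_f.
Qed.

Lemma alg_independent_recr m (x : 'I_m.+1 -> K) :
  alg_independent x <-> alg_independent (x \o lift ord_max) /\
    ~ algdep c (codom (x \o lift ord_max)) (x ord_max).
Proof.
have [s [t [sK tK tE]]] := mpoly_split_last k m.
split=> [indx|[indx trx] p px0].
  split=> [p px0|[p [p0 /(_ _)/adjoin_mmap xp px]]].
    apply: polyC_inj; rewrite raddf0; apply: (can_inj tK); rewrite rmorph0.
    by apply: indx; rewrite tE map_polyC hornerC.
  have /fin_all_exists[q qE] (i : 'I_(size p)) := xp i.
  pose Q := \poly_(i < size p) odflt 0 (omap q (insub i)).
  have QE : map_poly (mmap c (x \o lift ord_max)) Q = p.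
    apply/polyP => i; rewrite coef_map coef_poly; case: ltnP => [lti|lei].
      by rewrite insubT; exact/esym/(qE (Ordinal lti)).
    by rewrite raddf0 nth_default.
  have Q0 : Q = 0.
    by apply: (can_inj tK); rewrite rmorph0; apply: indx; rewrite tE QE;
      apply/rootP.
  by move: p0; rewrite -QE Q0 raddf0 eqxx.
rewrite -[p]sK tE in px0 *; suff -> : s p = 0 by rewrite rmorph0.
apply/polyP => i; rewrite coef0; apply: indx.
pose Q := map_poly (mmap c (x \o lift ord_max)) (s p).
have [Q0|Q0] := eqVneq Q 0; first by rewrite -coef_map -/Q Q0 coef0.
case: trx; exists Q; split=> //; last exact/rootP.
by move=> j; rewrite coef_map; apply/adjoin_mmap; exists (s p)`_j.
Qed.

(** Steinitz exchange: each independent element in turn takes the place of one element of [S]. *)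
Lemma independent_spans_exchange m (x : 'I_m -> K) S :
  alg_independent x -> spans c S ->
  exists2 S', (size S' + m)%N = size S & spans c (S' ++ codom x).
Proof.
elim: m x => [|m IH] x indx spS.
  by exists S; rewrite ?addn0 // => y; apply: algdep_subset (spS y) => z;
    rewrite mem_cat => ->.
have [indx' trx] := (alg_independent_recr x).1 indx.
have [S' sS spS'] := IH _ indx' spS.
have [S'' sS' spS''] := spans_exchange spS' trx.
exists S''; first by rewrite addnS -sS sS' addSn.
move=> y; apply: algdep_subset (spS'' y) => z.
rewrite !mem_cat inE => /orP[->//|/orP[/eqP ->|/codomP[i ->]]].
  by rewrite codom_f orbT.
by rewrite /= codom_f orbT.
Qed.

Lemma independent_le_spans m (x : 'I_m -> K) S :
  alg_independent x -> spans c S -> (m <= size S)%N.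
Proof.
by move=> indx /(independent_spans_exchange indx)[S' <- _]; exact: leq_addl.
Qed.

Lemma has_dim_spans d : has_dim X d ->
  exists x : 'I_d -> K, alg_independent x /\ spans c (codom x).
Proof.
move=> [[x indx] max_d]; exists x; split=> // y; apply: NNPP => try.
pose x' i := if unlift ord_max i is Some j then x j else y.
have x'x : x' \o lift ord_max =1 x by move=> j; rewrite /= /x' liftK.
apply: (max_d x'); apply/alg_independent_recr; rewrite /x' unlift_none.
rewrite (eq_codom x'x); split=> // p.
by rewrite (eq_mmap _ (frefl _) x'x); exact: indx.
Qed.

End Independence.

(** * Adding a variable with trivial action *)

Lemma mmap_coord (k : fieldType) m (p : {mpoly k[m]}) :
  mmap (const (affine_space k m)) (@Defs.coord k m) p = p%:F.
Proof. by rewrite -[in RHS](mmap_id p) mmap_comp. Qed.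

Lemma coord_independent (k : fieldType) m :
  alg_independent (X := affine_space k m) (@Defs.coord k m).
Proof. by move=> p; rewrite mmap_coord => /eqP; rewrite tofrac_eq0 => /eqP. Qed.

Lemma horner_P1_coord (k : fieldType) (X : prevariety k) (p : {poly funfield
  X}) :
  (map_poly (lift_fun X) p).[P1_coord X] = p%:F.
Proof.
have ct : commr_rmorph (lift_fun X) (P1_coord X) by move=> x; exact: mulrC.
apply: (@eq_poly_morph _ _ (horner_morph ct) (@FracField.tofrac _)) => [a|].
  exact: horner_morphC.
exact: horner_morphX.
Qed.

Section AdjoinVariable.
Variables (k : fieldType) (X X' : prevariety k).
Variable i : {rmorphism funfield X -> funfield X'}.
Hypothesis iC : forall a, i (const X a) = const X' a.

Lemma adjoin_rmorph L x :
  adjoin (const X) L x -> adjoin (const X') (map i L) (i x).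
Proof.
elim=> [a|y yL|y z _ IHy _ IHz|y z _ IHy _ IHz].
- by rewrite iC; exact: adjoin_const.
- by apply: adjoin_gen; exact: map_f.
- by rewrite rmorphD; exact: adjoin_add.
by rewrite rmorphM; exact: adjoin_mul.
Qed.

Lemma algdep_rmorph L x :
  algdep (const X) L x -> algdep (const X') (map i L) (i x).
Proof.
move=> [p [p0 Lp px]]; exists (map_poly i p); rewrite map_poly_eq0 fmorph_root.
by split=> // j; rewrite coef_map; exact: adjoin_rmorph.
Qed.

Lemma alg_independent_rmorph m (x : 'I_m -> funfield X) :
  alg_independent x -> alg_independent (X := X') (i \o x).
Proof.
move=> indx p px0; apply: indx; apply: (fmorph_inj i).
by rewrite rmorph0 -px0 mmap_comp; apply: eq_mmap => // a /=; rewrite iC.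
Qed.

End AdjoinVariable.

(** A transcendence basis of k(X) together with the coordinate [t] of the line is one of k(X)(t). *)
Lemma has_dim_timesP1 (k : fieldType) (X : prevariety k) d :
  has_dim X d -> has_dim (timesP1 X) d.+1.
Proof.
move=> /has_dim_spans[x [indx spx]].
pose X' := timesP1 X; pose t : funfield X' := P1_coord X.
pose i : {rmorphism funfield X -> funfield X'} := lift_fun X.
have iC a : i (const X a) = const X' a by [].
have iA a : algdep (const X') (map i (codom x)) (i a).
  by apply: algdep_rmorph => //; exact: spx.
split; last first.
  move=> z indz; suff /(independent_le_spans indz) : spans (const X') (t :: map
    i (codom x)).
    by rewrite /= size_map size_codom card_ord ltnn.
  have tA a : algdep (const X') (t :: map i (codom x)) (i a).
    by apply: algdep_subset (iA a) => y yL; rewrite inE yL orbT.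
  move=> y; have [p [q [_ ->]]] := fraction_repr y.
  have pA (r : {poly funfield X}) : algdep (const X') (t :: map i (codom x))
    r%:F.
    rewrite -horner_P1_coord horner_coef; elim/big_ind: _ => [|u v|j _].
    - exact/algdep_adjoin/adjoin0.
    - exact: algdepD.
    apply: algdepM; first by rewrite coef_map; exact: tA.
    by apply/algdep_adjoin/adjoinX/adjoin_gen; rewrite mem_head.
  by apply: algdepM; last apply: algdepV; exact: pA.
exists (fun l => if unlift ord_max l is Some j then i (x j) else t).
have xE : (fun l => if unlift ord_max l is Some j then i (x j) else t)
    \o lift ord_max =1 i \o x by move=> j; rewrite /= liftK.
apply/alg_independent_recr; rewrite unlift_none (eq_codom xE); split.
  by move=> p; rewrite (eq_mmap _ (frefl _) xE);
    exact: (alg_independent_rmorph iC indx).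
move=> [p [p0 Lp pt]].
(* A relation for [t] has its coefficients in the image of k(X), so it comes from a polynomial [Q]
   over k(X). Its value at [t] is [Q] itself viewed as a fraction, hence [Q] is zero. *)
suff /fin_all_exists[q qE] (j : 'I_(size p)) : exists a, p`_j = i a.
  pose Q := \poly_(j < size p) odflt 0 (omap q (insub j)).
  have QE : p = map_poly i Q.
    apply/polyP => j; rewrite coef_map coef_poly; case: ltnP => [ltj|lej].
      by rewrite insubT; exact: (qE (Ordinal ltj)).
    by rewrite raddf0 nth_default.
  move: pt p0; rewrite QE /root horner_P1_coord tofrac_eq0 => /eqP ->.
  by rewrite raddf0 eqxx.
elim: (Lp j) => [a|_ /codomP[l ->]|_ _ _ [a ->] _ [b ->]|_ _ _ [a ->] _ [b ->]].
- by exists (const X a).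
- by exists (x l).
- by exists (a + b); rewrite rmorphD.
by exists (a * b); rewrite rmorphM.
Qed.

Section Models.
Variables (k : fieldType) (gT : finGroupType) (G : {group gT}).

(* The action of G and the unirational parametrisation phi are given by their
   pullbacks. *)
Definition unirational_model d :=
  exists (X : variety k) (s : gT -> {rmorphism funfield X -> funfield X})
    m (phi : {rmorphism funfield X -> funfield (affine_space k m)}),
  [/\ has_dim X d,
      forall g a, s g (const X a) = const X a,
      s 1%g =1 id /\ {in G &, forall g h, s (g * h)%g =1 s h \o s g},
      forall g, g \in G -> s g =1 id -> g = 1%g
    & forall a, phi (const X a) = const (affine_space k m) a].

(** The group fixes the new variable, and [phi] is extended by sending it to one further coordinate
    of the affine space. *)
Lemma unirational_modelS d : unirational_model d -> unirational_model d.+1.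
Proof.
move=> [X [s [m [phi [dimX sC [s1 sM] s_faith phiC]]]]].
have [L LX] := chart_exists X.
have genL := timesP1_generates (mem_head _ _) (charts_gen LX).
pose i := lift_fun X; pose t := P1_coord X.
have /fin_all_exists[s' s'E] g : exists s' : {rmorphism {fraction {poly
  funfield X}} -> {fraction {poly funfield X}}}, s' t = t /\ forall a, s' (i a)
  = i (s g a).
  apply: (@fraction_poly_lift _ _ (i \o s g) t) => p.
  rewrite map_poly_comp horner_P1_coord => /eqP; rewrite tofrac_eq0.
  by rewrite map_poly_eq0 => /eqP.
have s'_eq (f1 f2 : {rmorphism {fraction {poly funfield X}} -> {fraction {poly
  funfield X}}}) :
    f1 t = f2 t -> (forall a, f1 (i a) = f2 (i a)) -> f1 =1 f2.
  move=> ft fi; apply: eq_fraction_morph.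
  exact: (@eq_poly_morph _ _ (f1 \o @FracField.tofrac _) (f2 \o
    @FracField.tofrac _)).
pose x := @Defs.coord k m.+1; pose V' := affine_space k m.+1.
have [indx trx] := (alg_independent_recr (X := V') x).1 (@coord_independent k
  m.+1).
have [sigma sigmaE] := fraction_mpoly_lift indx.
have sigmaC a : sigma (const (affine_space k m) a) = const V' a.
  by rewrite [LHS]sigmaE mmapC.
have [|phi' [phi't phi'i]] := @fraction_poly_lift _ _ (sigma \o phi) (x
  ord_max).
  move=> p px; have [//|p0] := eqVneq p 0; case: trx.
  apply: (@algdep_frac _ _ _ _ (map_poly (sigma \o phi) p)).
  - by rewrite map_poly_eq0.
  - move=> j; rewrite coef_map /=;
    have [a [b [b0 ->]]] := fraction_repr (phi p`_j).
    exists (sigma a%:F), (sigma b%:F); rewrite fmorph_eq0 tofrac_eq0 fmorph_div.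
    by split=> //; apply/(adjoin_mmap (X := V')); eexists; exact: sigmaE.
  exact/rootP.
exists (affine_model genL), s', m.+1, phi'; split.
- exact: (has_dim_timesP1 dimX).
- by move=> g a; rewrite (s'E g).2 sC.
- split; first by apply: (s'_eq _ idfun) => [|a];
    [exact: (s'E _).1|rewrite (s'E _).2 s1].
  move=> g h gG hG; apply: (s'_eq _ (s' h \o s' g)) => [|a] /=.
    by rewrite !(s'E _).1.
  by rewrite !(s'E _).2 sM.
- move=> g gG s'g1; apply: s_faith => // a; apply: (fmorph_inj i).
  by rewrite -(s'E g).2 s'g1.
by move=> a; rewrite phi'i /= phiC sigmaC.
Qed.

Lemma unirational_model_le d n :
  (d <= n)%N -> unirational_model d -> unirational_model n.
Proof.
move/subnK <-; elim: (n - d)%N => // l IH modd.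
by rewrite addSn; apply/unirational_modelS/IH.
Qed.

End Models.

(** * Unirational varieties are rationally connected *)

Section TwoPointLines.
Variables (k : fieldType) (m : nat).
Local Notation D := {mpoly k[m]}.
Local Notation T := (affine_space k (m + m)).
Local Notation TP := (timesP1 T).
Local Notation L := (funfield (timesP1 TP)).

(* The line through x and y, the first m and the last m coordinates. *)
Definition line (R : comNzRingType) (f : {rmorphism {mpoly k[m + m]} -> R})
    (t : R) (i : 'I_m) : R :=
  (1 - t) * f 'X_(lshift m i) + t * f 'X_(rshift m i).

Lemma line_rmorph (R S : comNzRingType) (f : {rmorphism {mpoly k[m + m]} -> R})
    (g : {rmorphism R -> S}) t i : g (line f t i) = line (g \o f) (g t) i.
Proof. by rewrite /line rmorphD !rmorphM rmorphB rmorph1. Qed.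

Lemma eq_line (R : comNzRingType) (f g : {rmorphism {mpoly k[m + m]} -> R}) t u
  :
  f =1 g -> t = u -> line f t =1 line g u.
Proof. by move=> fg -> i; rewrite /line !fg. Qed.

Let iT : {rmorphism {mpoly k[m + m]} -> funfield T} := @FracField.tofrac _.
Let iTP : {rmorphism {mpoly k[m + m]} -> funfield TP} := lift_fun T \o iT.

(** Points of the lines have polynomial coordinates. The computation is done in the polynomial ring
    k[x, y][a][b], where, unlike in the function field, the parameters a and b can be specialised;
    [j2] embeds this ring into [L]. *)
Let P2 : {rmorphism {mpoly k[m + m]} -> {poly {poly {mpoly k[m + m]}}}} :=
  polyC \o polyC.
Let cP : {rmorphism k -> {poly {poly {mpoly k[m + m]}}}} := P2 \o @mpolyC _ _.

Let j1 : {rmorphism {poly {mpoly k[m + m]}} -> funfield TP} :=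
  @FracField.tofrac _ \o map_poly iT.
Let j2 : {rmorphism {poly {poly {mpoly k[m + m]}}} -> L} :=
  @FracField.tofrac _ \o map_poly j1.

Let j1C x : j1 x%:P = lift_fun T (iT x).
Proof. by rewrite /j1 [LHS]/= map_polyC. Qed.
Let j1X : j1 'X = P1_coord T.
Proof. by rewrite /j1 [LHS]/= map_polyX. Qed.
Let j2C x : j2 x%:P = lift_fun TP (j1 x).
Proof. by rewrite /j2 [LHS]/= map_polyC. Qed.
Let j2X : j2 'X = P1_coord TP.
Proof. by rewrite /j2 [LHS]/= map_polyX. Qed.

Let j2_inj : injective j2.
Proof.
have j1_inj : injective j1.
  apply: raddf_inj => p /eqP; rewrite tofrac_eq0 => /eqP /polyP p0.
  apply/polyP => i; have /eqP := p0 i.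
  by rewrite coef_map !coef0 tofrac_eq0 => /eqP.
apply: raddf_inj => p /eqP; rewrite tofrac_eq0 => /eqP /polyP p0.
apply/polyP => i; have /eqP := p0 i; rewrite coef_map !coef0 => /eqP.
by rewrite -(rmorph0 j1) => /j1_inj.
Qed.

Let a0 : {rmorphism D -> {poly {poly {mpoly k[m + m]}}}} :=
  mmap cP (line P2 'X%:P).
Let b0 : {rmorphism D -> {poly {poly {mpoly k[m + m]}}}} :=
  mmap cP (line P2 'X).

Let a0C c : a0 c%:MP = cP c. Proof. exact: mmapC. Qed.
Let b0C c : b0 c%:MP = cP c. Proof. exact: mmapC. Qed.
Let a0X i : a0 'X_i = line P2 'X%:P i. Proof. exact: mmap_var. Qed.
Let b0X i : b0 'X_i = line P2 'X i. Proof. exact: mmap_var. Qed.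

(* Specialise the two parameters to 0 and 1: the two points of the line become
   the independent points x and y. *)
Let sp : {rmorphism {poly {poly {mpoly k[m + m]}}} -> {mpoly D[m]}} :=
  mmap (@mpolyC m D \o @mpolyC m k)
    (fun i => match split i with inl j => ('X_j)%:MP | inr j => 'X_j end)
  \o horner_eval 0 \o horner_eval 1.

Let spC c : sp (cP c) = (c%:MP)%:MP.
Proof. by rewrite /sp /cP /P2 /= /horner_eval !hornerC mmapC. Qed.

Let sp_l i : sp (P2 'X_(lshift m i)) = ('X_i)%:MP.
Proof.
rewrite /sp /P2 /= /horner_eval !hornerC mmap_var.
by rewrite -[lshift m i]/(unsplit (inl i)) unsplitK.
Qed.

Let sp_r i : sp (P2 'X_(rshift m i)) = 'X_i.
Proof.
rewrite /sp /P2 /= /horner_eval !hornerC mmap_var.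
by rewrite -[rshift m i]/(unsplit (inr i)) unsplitK.
Qed.

Let spa p : sp (a0 p) = p%:MP.
Proof.
have sp0 : sp ('X)%:P = 0.
  by rewrite /sp /= /horner_eval hornerC hornerX rmorph0.
apply: (@eq_mpoly_morph _ _ _ (sp \o a0) (@mpolyC m D)) => [c|i].
  by rewrite -[LHS]/(sp (a0 _)) a0C spC.
rewrite -[LHS]/(sp (a0 _)) a0X line_rmorph /line -!/(sp (P2 _)) sp0 subr0 mul0r
  mul1r addr0.
exact: sp_l.
Qed.

Let spb p : sp (b0 p) = map_mpoly (@mpolyC m k) p.
Proof.
have sp1 : sp 'X = 1.
  by rewrite /sp /= /horner_eval hornerX hornerC rmorph1.
apply: (@eq_mpoly_morph _ _ _ (sp \o b0) (map_mpoly (@mpolyC m k))) => [c|i].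
  rewrite -[LHS]/(sp (b0 _)) b0C spC; exact/esym/map_mpolyC.
rewrite -[LHS]/(sp (b0 _)) b0X line_rmorph /line -!/(sp (P2 _)) sp1 subrr mul0r
  mul1r add0r.
rewrite [RHS]map_mpolyX.
exact: sp_r.
Qed.

(** At a = 0 and b = 1 the relation becomes one between the p(x) and the q(y) in separate variables;
    the conclusion reads off the coefficient of each monomial in y. *)
Let key n (p q : 'I_n -> D) : \sum_l j2 (a0 (p l)) * j2 (b0 (q l)) = 0 ->
  forall M, \sum_l (q l)@_M *: p l = 0.
Proof.
rewrite (eq_bigr (fun l => j2 (a0 (p l) * b0 (q l)))) => [|l _];
  last by rewrite rmorphM.
rewrite -rmorph_sum -(rmorph0 j2) => /j2_inj /(congr1 sp).
rewrite rmorph0 rmorph_sum => sum0 M.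
have /(congr1 (mcoeff M)) := sum0; rewrite mcoeff0 raddf_sum => sumM.
rewrite -[RHS]sumM.
have spab l : sp (a0 (p l) * b0 (q l)) = (p l)%:MP * map_mpoly (@mpolyC m k) (q
  l).
  by rewrite rmorphM; congr (_ * _); [exact: spa|exact: spb].
apply: eq_bigr => l _; rewrite spab.
rewrite -[RHS]/(_@_M) mcoeffCM mcoeff_map_mpoly mulrC.
exact/esym/mul_mpolyC.
Qed.

Let c1 : {rmorphism k -> funfield TP} := const TP.

Let a1 : {rmorphism D -> funfield TP} := mmap c1 (line iTP (P1_coord T)).

Let a1C c : a1 c%:MP = c1 c. Proof. exact: mmapC. Qed.
Let a1X i : a1 'X_i = line iTP (P1_coord T) i. Proof. exact: mmap_var. Qed.

Let pa1 p : lift_fun TP (a1 p) = j2 (a0 p).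
Proof.
apply: (@eq_mpoly_morph _ _ _ (lift_fun TP \o a1) (j2 \o a0)) => [c|i].
  rewrite -[LHS]/(lift_fun TP (a1 _)) -[RHS]/(j2 (a0 _)) a1C a0C.
  by rewrite -[cP c]/((c%:MP)%:P)%:P j2C j1C.
rewrite -[LHS]/(lift_fun TP (a1 _)) -[RHS]/(j2 (a0 _)) a1X a0X !line_rmorph.
apply: eq_line => [x|]; last by rewrite j2C j1X.
by rewrite -[RHS]/(j2 (P2 x)) -[P2 x]/((x%:P)%:P) j2C j1C.
Qed.

(** The family consists of all lines through two points of affine space, with the space of pairs of
    points as base. Two points on a general line form a general pair, because the specialisation at
    parameters 0 and 1 already does. *)
Lemma lines_rat_map : exists (ul : {rmorphism funfield (affine_space k m) ->
  funfield TP})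
    (p q : {rmorphism funfield TP -> L}),
  [/\ forall a, ul (const (affine_space k m) a) = const TP a,
      forall x, p (lift_fun T x) = lift_fun TP (lift_fun T x) /\
                q (lift_fun T x) = lift_fun TP (lift_fun T x),
      p (P1_coord T) = lift_fun TP (P1_coord T), q (P1_coord T) = P1_coord TP
    & jointly_dominant (X := affine_space k m) (Y := affine_space k m)
        (p \o ul) (q \o ul)].
Proof.
have inda1 (p : D) : mmap c1 (line iTP (P1_coord T)) p = 0 -> p = 0.
  move=> p0; have /(congr1 sp) : a0 p = 0.
    by apply: j2_inj; rewrite -pa1 [a1 p]p0 !rmorph0.
  by rewrite spa rmorph0 => /eqP; rewrite mpolyC_eq0 => /eqP.
have [ul ulE] := fraction_mpoly_lift inda1.
have [|q [qt qC]] := @fraction_poly_lift _ _ (lift_fun TP \o lift_fun T)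
  (P1_coord TP).
  move=> p; rewrite map_poly_comp horner_P1_coord => /eqP.
  by rewrite tofrac_eq0 map_poly_eq0 => /eqP.
have qb p : q (a1 p) = j2 (b0 p).
  apply: (@eq_mpoly_morph _ _ _ (q \o a1) (j2 \o b0)) => [c|i].
    rewrite -[LHS]/(q (a1 _)) -[RHS]/(j2 (b0 _)) a1C b0C.
    by rewrite -[cP c]/((c%:MP)%:P)%:P j2C j1C [LHS]qC.
  rewrite -[LHS]/(q (a1 _)) -[RHS]/(j2 (b0 _)) a1X b0X !line_rmorph.
  apply: eq_line => [x|]; last by rewrite j2X.
  by rewrite -[RHS]/(j2 (P2 x)) -[P2 x]/((x%:P)%:P) j2C j1C; exact: qC.
exists ul, (lift_fun TP), q; split=> // [a|x|n x y indx sum0 i].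
- by rewrite [LHS]ulE mmapC.
- by split; last exact: qC.
have [P P0 [x' xE]] := fraction_common_denominator x.
have [Q Q0 [y' yE]] := fraction_common_denominator y.
have ula w : ul w%:F = a1 w by exact: ulE.
have ulx l : lift_fun TP (ul (x l)) = j2 (a0 (x' l)) / lift_fun TP (ul P%:F).
  by rewrite xE fmorph_div (fmorph_div (lift_fun TP)) -pa1 -ula.
have uly l : q (ul (y l)) = j2 (b0 (y' l)) / q (ul Q%:F).
  by rewrite yE fmorph_div (fmorph_div q) -qb -ula.
have Py0 : \sum_l j2 (a0 (x' l)) * j2 (b0 (y' l)) = 0.
  transitivity (lift_fun TP (ul P%:F) * q (ul Q%:F) * \sum_l lift_fun TP (ul (x
    l)) * q (ul (y l))).
    rewrite mulr_sumr; apply: eq_bigr => l _;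
      rewrite ulx uly mulf_div [RHS]mulrC.
    by rewrite divfK // mulf_neq0 // !fmorph_eq0 tofrac_eq0.
  by apply/eqP; rewrite mulf_eq0; apply/orP; right; apply/eqP.
rewrite yE; suff -> : y' i = 0 by rewrite rmorph0 mul0r.
apply/mpolyP => M; rewrite mcoeff0; apply: (indx (fun l => (y' l)@_M)).
rewrite (eq_bigr (fun l => ((y' l)@_M *: x' l)%:F / P%:F)) => [|l _].
  by rewrite -mulr_suml -rmorph_sum (key Py0) rmorph0 mul0r.
by rewrite xE mulrA -mul_mpolyC rmorphM.
Qed.

End TwoPointLines.

(** The images in [X] of the lines of the affine space form the required family. Joint dominance
    passes to [X] because [phi] is injective and k-linear, so it preserves linear independence. *)
Lemma unirational_rationally_connected (k : fieldType) (X : variety k) m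
    (phi : {rmorphism funfield X -> funfield (affine_space k m)}) :
  (forall a, phi (const X a) = const (affine_space k m) a) ->
  rationally_connected X.
Proof.
move=> phiC; have [ul [p [q [ulC pqT pt qt dom]]]] := lines_rat_map k m.
pose T := affine_space k (m + m).
have [u uE] : exists u : rat_map (timesP1 T) X, pullback u = ul \o phi.
  by apply: morph_rat_map => a; rewrite /= phiC ulC.
have [p' p'E] : exists p' : rat_map (timesP1 (timesP1 T)) (timesP1 T), pullback
  p' = p.
  by apply: morph_rat_map => a; exact: (pqT _).1.
have [q' q'E] : exists q' : rat_map (timesP1 (timesP1 T)) (timesP1 T), pullback
  q' = q.
  by apply: morph_rat_map => a; exact: (pqT _).2.
exists T, u, p', q'; rewrite p'E q'E uE; split=> // n x y indx sum0 i.
apply: (fmorph_inj phi); rewrite rmorph0.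
apply: (dom n (phi \o x) (phi \o y)) => // a xa0; apply: indx.
apply: (fmorph_inj phi); rewrite rmorph0 -xa0 rmorph_sum.
by apply: eq_bigr => l _; rewrite rmorphM phiC.
Qed.

Lemma unirational_model_jordan (k : fieldType) n j (gT : finGroupType) (G :
  {group gT}) :
  is_jordan_constant k n j -> unirational_model k G n ->
  exists A : {group gT}, [/\ (A <| G)%g, abelian A & (#|G : A|%g <= j)%N].
Proof.
move=> [_ jP] [X [s [m [phi [dimX sC [s1 sM] s_faith phiC]]]]].
(* [f] has to be defined on all of [gT], whereas [s g] is known to be invertible only on [G];
   elsewhere the identity is taken. *)
pose v g := if g \in G then g else 1%g.
have vG g : v g \in G by rewrite /v; case: ifP.
have /fin_all_exists[r rE] g : exists r : rat_map X X, pullback r = s g.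
  exact: morph_rat_map (sC g).
have /fin_all_exists[f fE] g : exists f : Bir X, pullback f = s (v g).
  suff invr : exists g' : rat_map X X, cancel (pullback (r (v g))) (pullback
    g') /\
      cancel (pullback g') (pullback (r (v g))) by exists (BirMap invr);
        exact: rE.
  exists (r (v g)^-1)%g; rewrite !rE; split=> x.
    by have := sM _ _ (vG g) (groupVr (vG g)) x; rewrite mulgV s1.
  by have := sM _ _ (groupVr (vG g)) (vG g) x; rewrite mulVg s1.
have rcX := unirational_rationally_connected phiC.
apply: (jP X dimX rcX gT G f); split=> g h gG hG.
  by rewrite !fE /v gG hG groupM //; exact: sM.
rewrite !fE /v gG hG => sgh; apply/eqP; rewrite eq_mulVg1; apply/eqP.
apply: s_faith => [|x]; first by rewrite groupM ?groupV.
rewrite sM ?groupV //= -sgh; have := sM _ _ (groupVr gG) gG x.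
by rewrite mulVg s1.
Qed.

(** * Induced monomial representations *)

(* The representation of G induced from the sum of the n characters of A is
   monomial, on a basis indexed by the characters and the cosets of A. *)
Lemma wreath_embedding (k : fieldType) (gT : finGroupType) (G A : {group gT})
    n j (chi : 'I_n -> gT -> k) :
  A \subset G -> (#|G : A|%g <= j)%N -> (0 < n)%N ->
  (forall l a, a \in A -> chi l a != 0) ->
  (forall l, {in A &, {morph chi l : a b / (a * b)%g >-> a * b}}) ->
  (forall a, a \in A -> (forall l, chi l a = 1) -> a = 1%g) ->
  exists f : gT -> Gm_wreath k (n * j),
     {in G &, {morph f : x y / (x * y)%g}} /\ {in G &, injective f}.
Proof.
move=> sAG index_le n_gt0 chi_neq0 chiM chi_inj.
pose cT := {C : {set gT} | C \in rcosets A G}.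
pose T : finType := ('I_n * cT)%type.
have leT : (#|T| <= n * j)%N.
  by rewrite card_prod card_ord leq_mul2l card_sig index_le orbT.
pose e (x : T) : 'I_(n * j) := widen_ord leT (enum_rank x).
have e_inj : injective e by move=> x y /(congr1 val) /= /val_inj /enum_rank_inj.
pose pre q := [pick x | e x == q].
have preK x : pre (e x) = Some x.
  by rewrite /pre; case: pickP => [y /eqP/e_inj -> //|/(_ x)]; rewrite eqxx.
have preP q x : pre q = Some x -> q = e x.
  by rewrite /pre; case: pickP => // y /eqP <- [->].
pose rep (C : cT) : gT := repr (val C).
pose mv g (C : cT) : cT := insubd C (val C :* g)%g.
have mvE g C : g \in G -> val (mv g C) = (val C :* g)%g.
  move=> gG; rewrite val_insubd; case: ifP => // /negP[].
  by have /rcosetsP[x xG ->] := valP C; rewrite -rcosetM; apply/rcosetsP;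
    exists (x * g)%g => //; exact: groupM.
have repE C : val C = (A :* rep C)%g.
  by have /rcosetsP[x xG CE] := valP C; rewrite /rep CE rcoset_repr.
have cocycle g C : g \in G -> (rep C * g * (rep (mv g C))^-1)%g \in A.
  move=> gG; rewrite -mem_rcoset -repE mvE // repE.
  by apply/rcosetP; exists (rep C) => //; exact: rcoset_refl.
(* The index of [A] may be smaller than [j]. Positions outside the image of [e] are left fixed, with
   scalar 1. *)
pose s g q := if pre q is Some (l, C) then e (l, mv g C) else q.
pose t g q : k :=
  if pre q is Some (l, C) then chi l (rep C * g * (rep (mv g C))^-1)%g else 1.
have mvM g h C : g \in G -> h \in G -> mv (g * h)%g C = mv h (mv g C).
  by move=> gG hG; apply: val_inj; rewrite !mvE ?groupM // rcosetM.
have sM g h q : g \in G -> h \in G -> s (g * h)%g q = s h (s g q).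
  move=> gG hG; rewrite /s; case E: (pre q) => [[l C]|]; last by rewrite E.
  by rewrite preK mvM.
have tM g h q : g \in G -> h \in G -> t (g * h)%g q = t g q * t h (s g q).
  move=> gG hG; rewrite /t /s; case E: (pre q) => [[l C]|];
    last by rewrite E mulr1.
  rewrite preK -chiM ?cocycle // mvM //; congr (chi l _).
  by rewrite !mulgA mulgKV.
have s1 q : s 1%g q = q.
  rewrite /s; case E: (pre q) => [[l C]|] //; rewrite (preP _ _ E);
    congr (e (l, _)).
  by apply: val_inj; rewrite mvE // rcoset1.
have /fin_all_exists[f fE] g : exists w : Gm_wreath k (n * j), g \in G ->
    (forall q, val w.1 q = t g q) /\ (forall q, w.2 q = s g q).
  have [gG|gG] := boolP (g \in G); last by exists (Gmw_one k (n * j)).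
  have t0 : [forall q, [ffun q => t g q] q != 0].
    apply/forallP => q; rewrite ffunE /t; case: (pre q) => [[l C]|];
      last exact: oner_neq0.
    by rewrite chi_neq0 ?cocycle.
  have sI : injective (s g).
    by apply: (can_inj (g := s g^-1%g)) => q; rewrite -sM ?groupV // mulgV s1.
  by exists (Torus t0, perm sI) => _; split=> q; rewrite ?ffunE ?permE.
exists f; split=> g h gG hG.
  have [ft fs] := fE _ (groupM gG hG); have [gt gs] := fE _ gG;
    have [ht hs] := fE _ hG.
  apply: Gmw_eq => [q|] /=; first by rewrite ft tM // ffunE gt ht gs.
  by apply/permP => q; rewrite permM fs gs hs sM.
move=> fgh; have [gt gs] := fE _ gG; have [ht hs] := fE _ hG.
(* The one coset [A] suffices. Equal permutations send it to the same coset, which is read off at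
   some character since n is positive; equal scalars then identify the two cocycle values by
   [chi_inj]. *)
have AG : gval A \in rcosets A G by apply/rcosetsP; exists 1%g;
  rewrite ?rcoset1.
pose C : cT := Sub (gval A) AG.
have mvgh : mv g C = mv h C.
  have := gs (e (Ordinal n_gt0, C)); rewrite fgh hs /s preK.
  by move/e_inj=> [->].
suff : (rep C * g * (rep (mv g C))^-1 = rep C * h * (rep (mv g C))^-1)%g.
  by move/mulIg/mulgI.
apply/eqP; rewrite eq_mulgV1; apply/eqP; apply: chi_inj.
  by rewrite groupM ?groupV ?cocycle // mvgh cocycle.
move=> l; set a := (rep C * g * _)%g; set b := (rep C * h * _)%g.
have aA : a \in A by exact: cocycle.
have bA : b \in A by rewrite /b mvgh; exact: cocycle.
apply: (mulIf (chi_neq0 l _ bA)); rewrite -chiM //;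
  last by rewrite groupM ?groupV.
rewrite mulgKV mul1r.
have := gt (e (l, C)); rewrite fgh ht /t preK => <-.
by rewrite /b mvgh.
Qed.

(** The wreath product is realised by monomial matrices, with the i-th torus coordinate in row i and
    in the column to which the permutation sends i. *)
Lemma wreath_faithful (k : fieldType) r (gT : finGroupType) (G : {group gT})
    (f : gT -> Gm_wreath k r) :
  {in G &, {morph f : x y / (x * y)%g}} -> {in G &, injective f} ->
  exists rG : mx_representation k G r, mx_faithful rG.
Proof.
move=> fM f_inj.
pose M (w : Gm_wreath k r) : 'M[k]_r :=
  \matrix_(i, l) (val w.1 i *+ (w.2 i == l)).
have MM v w : M (v * w)%g = M v *m M w.
  apply/matrixP => i l; rewrite !mxE (bigD1 (v.2 i)) //= big1 ?addr0.
    by rewrite !mxE eqxx mulr1n !ffunE permM mulrnAr.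
  by move=> x /negPf xv; rewrite !mxE eq_sym xv mul0r.
have M_inj : injective M.
  move=> v w /matrixP Mvw; have vw i : v.2 i = w.2 i.
    have := Mvw i (v.2 i); rewrite !mxE eqxx; case: eqP => // _ /eqP.
    by rewrite (negPf (torus_neq0 _ _)).
  apply: Gmw_eq => [i|]; last exact/permP.
  by have := Mvw i (v.2 i); rewrite !mxE vw eqxx !mulr1n.
have f1 : f 1%g = 1%g.
  by apply: (mulgI (f 1%g)); rewrite -fM // !mulg1.
have M1 : M 1%g = 1%:M.
  by apply/matrixP => i l; rewrite !mxE ffunE perm1.
have rM : mx_repr G (M \o f).
  by split=> [|x y xG yG] /=; [rewrite f1 M1|rewrite fM // MM].
exists (MxRepresentation rM); apply/subsetP => x; rewrite !inE mul1mx.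
case/andP=> xG /eqP /= fx1; apply/eqP; apply: f_inj => //.
by apply: M_inj; rewrite f1 M1.
Qed.

Lemma rdim_exists (k : fieldType) N (gT : finGroupType) (G : {group gT}) :
  (0 < N)%N -> (exists rG : mx_representation k G N, mx_faithful rG) ->
  exists2 r, is_rdim k G r & (r <= N)%N.
Proof.
pose P r := (0 < r)%N /\ exists rG : mx_representation k G r, mx_faithful rG.
move=> N0 faithN; have : P N by [].
elim/ltn_ind: {N0 faithN} N => N IH PN.
have [[r [ltrN Pr]]|minN] := classic (exists r, (r < N)%N /\ P r).
  by have [r' r'G ler'] := IH _ ltrN Pr; exists r' => //;
    exact: leq_trans (ltnW ltrN).
case: PN => N0 faithN; exists N => //; split=> // r rG r0 faith_r.
by rewrite leqNgt; apply/negP => ltrN; apply: minN; exists r; split=> //;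
  split=> //; exists rG.
Qed.

(** * Simultaneous diagonalisation and integer lattices *)

(** The matrices commute and are killed by X^e - 1, which has e distinct roots in k. The rows of [P]
    are the linear forms that are eigenvectors of [A]. *)
Lemma abelian_codiagonalizable (k : fieldType) (gT : finGroupType) (G A :
  {group gT})
    m (rG : mx_representation k G m) e (z : k) :
  A \subset G -> abelian A -> (exponent G %| e)%N -> e.-primitive_root z ->
  exists2 P : 'M[k]_m, P \in unitmx & exists delta : gT -> 'I_m -> k,
    forall g, g \in A -> P *m rG g = diag_mx (\row_i delta g i) *m P.
Proof.
move=> sAG abA expG prim_z.
suff [P Punit /allP diagP] : codiagonalizable [seq rG g | g in A].
  exists P => //; have /fin_all_exists[delta deltaE] g : exists D : 'I_m -> k,
      g \in A -> P *m rG g = diag_mx (\row_i D i) *m P.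
    have [gA|] := boolP (g \in A); last by exists (fun=> 0).
    have /diagP /diagonalizable_forPex[D /(simmxP Punit) DE] : rG g \in [seq rG
      g | g in A].
      exact: image_f.
    by exists (D 0) => _; rewrite DE; congr (diag_mx _ *m _); apply/rowP => i;
      rewrite mxE.
  by exists delta.
apply/codiagonalizableP;
  split=> [_ _ /imageP[g gA ->] /imageP[h hA ->]|_ /imageP[g gA ->]].
  rewrite /comm_mx -!repr_mxM ?(subsetP sAG) //.
  by rewrite (centsP abA g gA h hA).
case: m rG => [|m] rG; first by rewrite (thinmx0 (rG g));
  exact: diagonalizable0.
apply/diagonalizableP; exists [seq z ^+ i | i <- index_iota 0 e].
  rewrite map_inj_in_uniq ?iota_uniq // => i l;
    rewrite !mem_index_iota /= => lti ltl.
  by move/eqP; rewrite (eq_prim_root_expr prim_z) !modn_small // => /eqP.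
rewrite big_map factor_Xn_sub_1 //; apply: mxminpoly_min.
rewrite rmorphB rmorphXn /= horner_mx_X rmorph1.
have gG : g \in G := subsetP sAG g gA.
have rX i : rG g ^+ i = rG (g ^+ i)%g.
  by elim: i => [|i IH];
    rewrite ?expr0 ?repr_mx1 // exprS IH expgS repr_mxM ?groupX.
by rewrite rX (exponentP expG g gG) repr_mx1 subrr.
Qed.

(** In the Smith form M = L D R take B = D R: its rows are multiples of rows of the invertible [R],
    so the nonzero ones are independent. As [B] is an integral combination of the rows of [M], its
    rows are values whenever those of [M] are. *)
Lemma int_row_echelon N m (M : 'M[int]_(N, m)) :
  exists (L U : 'M[int]_N) (B : 'M[int]_(N, m)),
  [/\ M = L *m B, B = U *m M
    & forall w : 'rV_N, w *m B = 0 -> forall l, row l B != 0 -> w 0 l = 0].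
Proof.
have [L Lu [R Ru [d _ ME]]] := int_Smith_normal_form M.
set D := \matrix_(i, j) _ in ME.
exists L, (invmx L), (D *m R); split=> [||w wB l lB].
- by rewrite mulmxA.
- by rewrite ME -mulmxA mulKmx.
have wD : w *m D = 0 by rewrite -[D](mulmxK Ru) mulmxA wB mul0mx.
have [j Dlj] : exists j, D l j != 0.
  apply/existsP; apply: contraNT lB; rewrite negb_exists => /forallP D0.
  rewrite row_mul (_ : row l D = 0) ?mul0mx //.
  by apply/rowP => j; rewrite mxE [RHS]mxE; have /negbNE/eqP := D0 j.
have lj : l = j :> nat.
  by apply/eqP; apply: contraNT Dlj => /negPf lj; rewrite mxE lj mulr0n.
have /rowP/(_ j) := wD; rewrite !mxE (bigD1 l) //= big1 ?addr0 => [/eqP|i il].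
  by rewrite mulf_eq0 (negPf Dlj) orbF => /eqP.
rewrite mxE -lj; case: eqP => [/val_inj il'|]; last by rewrite mulr0n mulr0.
by rewrite il' eqxx in il.
Qed.

(** * The monomial valuation *)

Section MonomialCharacters.
Variables (k : fieldType) (m : nat).
Implicit Types (t : 'I_m -> k) (g : 'rV[int]_m) (p u v : {mpoly k[m]}).

Definition monomial_char g t : k := \prod_i t i ^ g 0 i.

Lemma monomial_char0 t : monomial_char 0 t = 1.
Proof. by rewrite /monomial_char big1 // => i _; rewrite mxE expr0z. Qed.

Lemma monomial_char_neq0 g t : (forall i, t i != 0) -> monomial_char g t != 0.
Proof. by move=> t0; apply/prodf_neq0 => i _; rewrite expfz_neq0. Qed.

Lemma monomial_charD g h t : (forall i, t i != 0) ->
  monomial_char (g + h) t = monomial_char g t * monomial_char h t.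
Proof.
by move=> t0; rewrite -big_split /=; apply: eq_bigr => i _; rewrite mxE expfzDr.
Qed.

Lemma monomial_charZ (z : int) g t : (forall i, t i != 0) ->
  monomial_char (z *: g) t = monomial_char g t ^ z.
Proof.
move=> t0; rewrite /monomial_char.
transitivity (\prod_i (t i ^ g 0 i) ^ z).
  by apply: eq_bigr => i _; rewrite mxE exprz_exp mulrC.
by symmetry; apply: (big_morph (fun x : k => x ^ z)) => [x y|];
  rewrite ?exp1rz ?expfzMl.
Qed.

Lemma monomial_char_mul g s t w : (forall i, w i = s i * t i) ->
  monomial_char g w = monomial_char g s * monomial_char g t.
Proof.
by move=> wE; rewrite -big_split /=; apply: eq_bigr => i _; rewrite wE expfzMl.
Qed.

Definition lead_row u v : 'rV[int]_m :=
  \row_i ((mlead u i)%:Z - (mlead v i)%:Z).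

Lemma monomial_char_lead u v t : (forall i, t i != 0) ->
  monomial_char (lead_row u v) t = mmap1 t (mlead u) / mmap1 t (mlead v).
Proof.
move=> t0; rewrite /monomial_char /mmap1 -prodf_div; apply: eq_bigr => i _.
by rewrite mxE expfzDr // -exprnN.
Qed.

Definition scale_vars t : {mpoly k[m]} -> {mpoly k[m]} :=
  mmap (@mpolyC m k) (fun i => t i *: 'X_i).
HB.instance Definition _ t := GRing.RMorphism.on (scale_vars t).

Lemma mcoeff_scale_vars t p M : (scale_vars t p)@_M = p@_M * mmap1 t M.
Proof.
elim/mpolyind: p => [|a M' p _ _ IH]; first by rewrite raddf0 mcoeff0 mul0r.
rewrite raddfD /= !mcoeffD IH mulrDl; congr (_ + _).
rewrite /scale_vars mmapZ mmapX.
have -> : mmap1 (fun i => t i *: 'X_i) M' = mmap1 t M' *: ('X_[M'] : {mpoly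
  k[m]}).
  rewrite /mmap1 mpolyXE_id -scaler_prod; apply: eq_bigr => i _.
  by rewrite exprZn.
rewrite mul_mpolyC !mcoeffZ mcoeffX -mulrA; congr (_ * _).
by case: eqP => [->|_]; rewrite ?mulr1 ?mul1r ?mulr0 ?mul0r.
Qed.

End MonomialCharacters.

Lemma max_in_seq (T : eqType) d (O : orderType d) (f : T -> O) (s : seq T) (y :
  T) :
  y \in s -> exists2 x, x \in s & forall z, z \in s -> (f z <= f x)%O.
Proof.
elim: s y => // a [|b s] IH y _.
  by exists a; rewrite ?mem_head // => z; rewrite inE => /eqP ->.
have [x xs max_x] := IH b (mem_head _ _).
have [lexa|ltax] := Order.TotalTheory.leP (f x) (f a).
  exists a; rewrite ?mem_head // => z;
    rewrite inE => /predU1P[->|/max_x lezx] //.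
  exact: Order.POrderTheory.le_trans lezx lexa.
exists x => [|z]; first by rewrite inE xs orbT.
rewrite inE => /predU1P[->|/max_x] //.
exact: Order.POrderTheory.ltW.
Qed.

Section Values.
Variables (k : fieldType) (m : nat) (E : fieldType) (mu : {rmorphism {mpoly
  k[m]} -> E}).
Hypothesis mu_inj : injective mu.
Hypothesis mu_frac : forall F, exists u v : {mpoly k[m]}, v != 0 /\ F = mu u /
  mu v.
Variables (X : prevariety k) (psi : {rmorphism funfield X -> E}).
Hypothesis psiC : forall a, psi (const X a) = mu a%:MP.
Local Notation K := (funfield X).
Implicit Types (x y : K) (g h : 'rV[int]_m).

Let mu_neq0 u : u != 0 -> mu u != 0.
Proof. by rewrite -(rmorph0 mu) (inj_eq mu_inj). Qed.

(* The valuation of K induced by the monomial order. *)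
Definition has_value g x :=
  exists u v, [/\ u != 0, v != 0, psi x = mu u / mu v & g = lead_row u v].

Lemma has_value1 : has_value 0 1.
Proof.
exists 1, 1; rewrite oner_eq0 !rmorph1 divr1; split=> //.
by apply/rowP => i; rewrite !mxE subrr.
Qed.

Lemma has_valueM g h x y :
  has_value g x -> has_value h y -> has_value (g + h) (x * y).
Proof.
move=> [u [v [u0 v0 xE ->]]] [w [z [w0 z0 yE ->]]].
exists (u * w), (v * z); rewrite !mulf_neq0 //; split=> //.
  by rewrite !rmorphM xE yE mulf_div.
by apply/rowP => i; rewrite !mxE !mleadM // !mnmDE !PoszD opprD addrACA.
Qed.

Lemma has_valueV g x : has_value g x -> has_value (- g) x^-1.
Proof.
move=> [u [v [u0 v0 xE ->]]]; exists v, u; split=> //.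
  by rewrite fmorphV xE invf_div.
by apply/rowP => i; rewrite !mxE opprB.
Qed.

Lemma has_valueZ (z : int) g x : has_value g x -> has_value (z *: g) (x ^ z).
Proof.
move=> gx; have gxn n : has_value (n%:Z *: g) (x ^+ n).
  elim: n => [|n IH]; first by rewrite scale0r expr0; exact: has_value1.
  by rewrite exprS intS scalerDl scale1r; exact: has_valueM.
case: z => n; first exact: gxn.
by rewrite NegzE scaleNr -exprnN; exact: has_valueV.
Qed.

Lemma has_value_sum (I : finType) (w : I -> int) (g : I -> 'rV[int]_m) (x : I
  -> K) :
  (forall i, has_value (g i) (x i)) ->
  has_value (\sum_i w i *: g i) (\prod_i x i ^ w i).
Proof.
move=> gx; elim/big_rec2: _ => [|i y h _ IH]; first exact: has_value1.
by apply: has_valueM => //; exact: has_valueZ.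
Qed.

(* Abhyankar's inequality, for the monomial valuation. *)
Lemma independent_values s (x : 'I_s -> K) (g : 'I_s -> 'rV[int]_m) :
  (forall l, has_value (g l) (x l)) ->
  (forall w : 'I_s -> int, \sum_l w l *: g l = 0 -> forall l, w l = 0) ->
  alg_independent x.
Proof.
move=> gx indg p px0.
have /fin_all_exists[u /fin_all_exists[v uvE]] l := gx l.
have u0 l : u l != 0 by have [] := uvE l.
have v0 l : v l != 0 by have [] := uvE l.
(* The monomial x^M with denominators cleared. The exponent [msize p] bounds every exponent in [p],
   so one common factor serves for all terms. *)
pose F (M : 'X_{1..s}) := \prod_l (u l ^+ M l * v l ^+ (msize p - M l)).
have F0 M : F M != 0 by apply/prodf_neq0 => l _; rewrite mulf_neq0 ?expf_neq0.
have leM M l : M \in msupp p -> (M l <= msize p)%N.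
  move=> /msize_mdeg_lt /ltnW; apply: leq_trans.
  by rewrite mdegE (bigD1 l) //= leq_addr.
have FE M : M \in msupp p ->
    psi (mmap1 x M) * mu (\prod_l v l ^+ msize p) = mu (F M).
  move=> Mp; rewrite /mmap1 !rmorph_prod -big_split; apply: eq_bigr => l _ /=.
  have [_ _ xE _] := uvE l; rewrite !rmorphXn rmorphM !rmorphXn xE.
  rewrite -[in LHS](subnK (leM M l Mp)) exprD mulrCA -exprMn divfK ?mu_neq0 //.
  by rewrite mulrC.
have sumF : \sum_(M <- msupp p) p@_M *: F M = 0.
  apply: mu_inj; rewrite rmorph0 -(mul0r (mu (\prod_l v l ^+ msize p))).
  rewrite -(rmorph0 psi) -px0 !rmorph_sum mulr_suml; apply: eq_big_seq => M Mp.
  by rewrite -mul_mpolyC !rmorphM -psiC -FE // mulrA.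
have [p0|] := eqVneq p 0; first by [].
rewrite -msupp_eq0 => suppp; have [M0 M0p] : exists M, M \in msupp p.
  by case: (msupp p) suppp => // M r _; exists M; rewrite mem_head.
have [M Mp maxM] := max_in_seq (fun M => mlead (F M)) M0p.
(* The leading exponents of [F M'] and [F M] differ by the combination of the values [g l] with
   coefficients M'_l - M_l. By independence, distinct terms have distinct leading monomials, and the
   largest one cannot cancel. *)
have FM_inj M' : mlead (F M') = mlead (F M) -> M' \in msupp p -> M' = M.
  move=> leadE M'p; apply/mnmP => l; apply/eqP; rewrite -eqz_nat -subr_eq0;
    apply/eqP.
  move: l; apply: indg; apply/rowP => i; rewrite summxE [RHS]mxE.
  have leadF M1 : M1 \in msupp p -> (mlead (F M1) i)%:Z =
      \sum_l ((M1 l)%:Z * g l 0 i + (msize p)%:Z * (mlead (v l) i)%:Z).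
    move=> M1p; rewrite mlead_prod => [|l _ _];
      last by rewrite mulf_neq0 ?expf_neq0.
    rewrite mnm_sumE (big_morph Posz PoszD (erefl _)); apply: eq_bigr => l _.
    rewrite mleadM ?expf_neq0 // !mleadX // mnmDE !mulmnE PoszD !PoszM.
    have [_ _ _ ->] := uvE l; rewrite mxE -subzn ?leM //.
    by ring.
  have := leadF _ M'p; rewrite leadE leadF // => /eqP.
  rewrite -subr_eq0 -sumrB => /eqP sum0;
    rewrite -[RHS]oppr0 -[in RHS]sum0 -sumrN.
  by apply: eq_bigr => l _; rewrite mxE; ring.
have /(congr1 (mcoeff (mlead (F M)))) := sumF.
rewrite mcoeff0 raddf_sum (bigD1_seq M) //= big1_seq ?addr0 => [/eqP|M'
  /andP[M'M M'p]].
  by rewrite mcoeffZ mulf_eq0 mleadc_eq0 (negPf (F0 M)) orbF mcoeff_eq0 Mp.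
rewrite mcoeffZ [X in _ * X]mcoeff_gt_mlead ?mulr0 //.
rewrite Order.POrderTheory.lt_neqAle maxM // andbT.
by apply: contra_neq M'M => /FM_inj; apply.
Qed.

(* Otherwise the automorphism fixes the leading term of every element of K,
   hence N times the leading term of s x - x is the leading term of the sum of
   the s^i (s x - x) for i < N, which vanishes. *)
Lemma separating_value N (s : {rmorphism K -> K}) (a : {rmorphism E -> E})
    (t : 'I_m -> k) x : [pchar k] =i pred0 -> (0 < N)%N ->
  (forall y, a (psi y) = psi (s y)) -> (forall p, a (mu p) = mu (scale_vars t
    p)) ->
  (forall i, t i != 0) -> (forall i, t i ^+ N = 1) -> (forall y, iter N s y =
    y) ->
  s x != x -> exists g y, has_value g y /\ monomial_char g t != 1.
Proof.
case: N => // N char_k _ apsi amu t0 tN sN sx; apply: NNPP => none.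
have fixed g y : has_value g y -> monomial_char g t = 1.
  by move=> gy; apply/eqP/negPn/negP => gt; apply: none; exists g, y.
have mcoeff_iter i p M : (iter i (scale_vars t) p)@_M = p@_M * mmap1 t M ^+ i.
  elim: i => [|i IH]; first by rewrite mulr1.
  by rewrite iterS mcoeff_scale_vars IH exprSr mulrA.
have tM0 M : mmap1 t M != 0 by apply/prodf_neq0 => i _; rewrite expf_neq0.
have iter_neq0 i p : p != 0 -> iter i (scale_vars t) p != 0.
  apply: contraNneq => it0; have /esym/eqP := mcoeff_iter i p (mlead p).
  by rewrite it0 mcoeff0 mulf_eq0 mleadc_eq0 (negPf (expf_neq0 _ (tM0 _))) orbF.
(* The sum of the iterates of [s] on [y] telescopes to zero, as [s] has finite order. *)
pose y := s x - x; have y0 : y != 0 by rewrite subr_eq0.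
have [u [v [v0 yE]]] := mu_frac (psi y).
have u0 : u != 0.
  by apply: contra_neq y0 => u0; apply: (fmorph_inj psi);
    rewrite yE u0 !rmorph0 mul0r.
(* [N] has become the order minus one, so [w] is the product of the other conjugates of [v]. The new
   denominator [v * w] is the norm of [v], invariant under the scaling, and the vanishing sum can be
   read on numerators alone. *)
pose w := \prod_(i < N) iter i.+1 (scale_vars t) v.
have w0 : w != 0 by apply/prodf_neq0 => i _; exact: iter_neq0.
pose u' := u * w; pose v' := v * w.
have u'0 : u' != 0 by rewrite mulf_neq0.
have v'0 : v' != 0 by rewrite mulf_neq0.
have v'fix : scale_vars t v' = v'.
  have vN : iter N.+1 (scale_vars t) v = v.
    apply/mpolyP => M; rewrite mcoeff_iter /mmap1 -prodrXl big1 ?mulr1 // => i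
      _.
    by rewrite exprAC tN expr1n.
  have -> : v' = \prod_(i < N.+1) iter i (scale_vars t) v by rewrite
    big_ord_recl.
  rewrite rmorph_prod big_ord_recr /= -/(iter N.+1 _ v) vN mulrC big_ord_recl.
  by congr (_ * _).
(* Scaling multiplies the leading coefficient of the invariant [v'] by this scalar, which must
   therefore be 1. *)
have tv' : mmap1 t (mlead v') = 1.
  have := mcoeff_scale_vars t v' (mlead v'); rewrite v'fix -[LHS]mulr1.
  by move/(mulfI _)=> <- //; rewrite mleadc_eq0.
have y'E : psi y = mu u' / mu v'.
  by rewrite yE !rmorphM -mulf_div divff ?mulr1 // mu_neq0.
have tu' : mmap1 t (mlead u') = 1.
  have := fixed (lead_row u' v') y; rewrite monomial_char_lead // tv' divr1.
  by apply; exists u', v'.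
have sumu' : \sum_(i < N.+1) iter i (scale_vars t) u' = 0.
  have psi_iter i : psi (iter i s y) = mu (iter i (scale_vars t) u') / mu v'.
    elim: i => [|i IH]; first exact: y'E.
    by rewrite !iterS -apsi IH fmorph_div !amu v'fix.
  apply: mu_inj; rewrite rmorph0 rmorph_sum;
    apply: (mulIf (invr_neq0 (mu_neq0 v'0))).
  rewrite mul0r mulr_suml; transitivity (psi (\sum_(i < N.+1) iter i s y)).
    by rewrite rmorph_sum; apply: eq_bigr => i _; rewrite psi_iter.
  have iter_y i : iter i s y = iter i.+1 s x - iter i s x.
    by elim: i => // i IH; rewrite iterS IH rmorphB.
  rewrite -(big_mkord predT (fun i => iter i s y)).
  rewrite (eq_bigr (fun i => iter i.+1 s x - iter i s x)) => [|i _];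
    last exact: iter_y.
  by rewrite telescope_sumr // sN subrr rmorph0.
have /(congr1 (mcoeff (mlead u'))) := sumu'.
rewrite mcoeff0 raddf_sum (eq_bigr (fun=> u'@_(mlead u'))) => [|i _];
  last first.
  by rewrite /= mcoeff_iter tu' expr1n mulr1.
rewrite sumr_const card_ord -mulr_natr => /eqP.
rewrite mulf_eq0 mleadc_eq0 (negPf u'0) /=.
by rewrite ((pcharf0P k).1 char_k).
Qed.

End Values.

(** * Eigencoordinates and the characters of an abelian subgroup *)

Section LinearForms.
Variables (k : fieldType) (m : nat).
Implicit Types (P Q : 'M[k]_m).

Definition linear_subst P : {mpoly k[m]} -> {mpoly k[m]} :=
  mmap (@mpolyC m k) (fun i => \sum_j P i j *: 'X_j).
HB.instance Definition _ P := GRing.RMorphism.on (linear_subst P).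

Lemma linear_substC P a : linear_subst P a%:MP = a%:MP.
Proof. exact: mmapC. Qed.

Lemma linear_substX P i : linear_subst P 'X_i = \sum_j P i j *: 'X_j.
Proof. exact: mmap_var. Qed.

Lemma linear_substZ P a p : linear_subst P (a *: p) = a *: linear_subst P p.
Proof. by rewrite -!mul_mpolyC rmorphM /= linear_substC. Qed.

Lemma linear_substK P Q : P *m Q = 1%:M -> cancel (linear_subst P)
  (linear_subst Q).
Proof.
move=> PQ; apply: (@eq_mpoly_morph _ _ _ (linear_subst Q \o linear_subst P)
  idfun) => [a|i].
  by rewrite /= !linear_substC.
rewrite /= linear_substX rmorph_sum /=.
transitivity (\sum_l (P *m Q) i l *: ('X_l : {mpoly k[m]})).
  under eq_bigr => j _ do rewrite linear_substZ linear_substX scaler_sumr.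
  rewrite exchange_big; apply: eq_bigr => l _ /=.
  by rewrite mxE scaler_suml; apply: eq_bigr => j _; rewrite scalerA.
rewrite PQ (bigD1 i) //= mxE eqxx scale1r big1 ?addr0 // => l li.
by rewrite mxE eq_sym (negPf li) scale0r.
Qed.

End LinearForms.

(** Each nontrivial element of [A] is detected by the value of some function on [X]; an independent
    system generating the lattice of these finitely many values has at most d members, and its
    characters detect the same elements. *)
Lemma abelian_characters (k : fieldType) (gT : finGroupType) (G A : {group gT})
    (X : variety k) (f : gT -> rat_map X X) d n e (z : k) :
  [pchar k] =i pred0 -> (exponent G %| e)%N -> e.-primitive_root z ->
  A \subset G -> abelian A -> faithful_linearizable G f -> has_dim X d -> (d <=
    n)%N ->
  exists chi : 'I_n -> gT -> k,
  [/\ forall l a, a \in A -> chi l a != 0,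
      forall l, {in A &, {morph chi l : a b / (a * b)%g >-> a * b}}
    & forall a, a \in A -> (forall l, chi l a = 1) -> a = 1%g].
Proof.
move=> char_k expG prim_z sAG abA [[_ f1 fM] f_faith [m [rG [a [phi [[_ aX]
  aphi]]]]]].
move=> [_ max_d] le_dn.
have [P Pu [delta deltaE]] := abelian_codiagonalizable rG sAG abA expG prim_z.
have AG := subsetP sAG.
have delta1 i : delta 1%g i = 1.
  have := deltaE _ (group1 A);
    rewrite repr_mx1 mulmx1 => /(congr1 (mulmxr (invmx P))).
  by rewrite /= mulmxV // mulmxK // => /matrixP/(_ i i); rewrite !mxE eqxx.
have deltaM g h i : g \in A -> h \in A -> delta (g * h)%g i = delta g i * delta
  h i.
  move=> gA hA; have := deltaE _ (groupM gA hA).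
  rewrite repr_mxM ?AG // mulmxA deltaE // -mulmxA deltaE // mulmxA.
  move/(congr1 (mulmxr (invmx P))); rewrite /= !mulmxK // mulmx_diag.
  by move/matrixP/(_ i i); rewrite !mxE eqxx.
have delta0 g i : g \in A -> delta g i != 0.
  move=> gA; apply/eqP => g0; have := deltaM g g^-1%g i gA (groupVr gA).
  by rewrite mulgV delta1 g0 mul0r => /eqP; rewrite oner_eq0.
have deltaX g i l : g \in A -> delta (g ^+ l)%g i = delta g i ^+ l.
  by move=> gA; elim: l => [|l IH];
    rewrite ?delta1 // expgS deltaM ?groupX // IH exprS.
pose E := funfield (affine_space k m).
(* The variables stand for eigenforms of [A]: leading monomials are taken in these coordinates,
   where [A] acts by [scale_vars]. *)
pose mu : {rmorphism {mpoly k[m]} -> E} := @FracField.tofrac _ \o linear_subst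
  P.
have PK := linear_substK (mulmxV Pu); have VK := linear_substK (mulVmx Pu).
have mu_inj : injective mu.
  by move=> p q /eqP; rewrite tofrac_eq (can_eq PK) => /eqP.
have mu_frac (F : E) : exists u v : {mpoly k[m]}, v != 0 /\ F = mu u / mu v.
  have [u [v [v0 ->]]] := fraction_repr F.
  exists (linear_subst (invmx P) u), (linear_subst (invmx P) v);
    rewrite /mu /= !VK.
  by rewrite -(rmorph0 (linear_subst (invmx P))) (can_eq VK).
have muC c : mu c%:MP = const (affine_space k m) c.
  by rewrite /mu /= linear_substC.
have muX i : mu 'X_i = \sum_j const (affine_space k m) (P i j) * Defs.coord k j.
  rewrite /mu /= linear_substX rmorph_sum; apply: eq_bigr => j _.
  by rewrite -mul_mpolyC rmorphM.
have psiC c : pullback phi (const X c) = mu c%:MP by rewrite pullback_const muC.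
have amu g p : g \in A -> pullback (a g) (mu p) = mu (scale_vars (delta g) p).
  move=> gA; move: p.
  apply: (@eq_mpoly_morph _ _ _ (pullback (a g) \o mu) (mu \o scale_vars (delta
    g))) => [c|i].
    by rewrite -[LHS]/(pullback (a g) (mu _)) muC pullback_const -muC;
      congr (mu _);
      exact/esym/mmapC.
  rewrite -[LHS]/(pullback (a g) (mu _)) -[RHS]/(mu (scale_vars _ _)).
  rewrite /scale_vars mmap_var -mul_mpolyC rmorphM muC !muX rmorph_sum
    mulr_sumr.
  transitivity (\sum_l const (affine_space k m) ((P *m rG g) i l) * Defs.coord
    k l).
    under eq_bigr => j _ do rewrite rmorphM aX ?AG // pullback_const mulr_sumr.
    rewrite exchange_big; apply: eq_bigr => l _.
    rewrite mxE rmorph_sum mulr_suml; apply: eq_bigr => j _.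
    by rewrite rmorphM mulrA.
  apply: eq_bigr => l _; rewrite deltaE // mul_diag_mx !mxE rmorphM mulrA.
  by [].
have sep g : exists gam y, has_value mu (pullback phi) gam y /\
    (g \in A -> g != 1%g -> monomial_char gam (delta g) != 1).
  have [gA|] := boolP (g \in A); last by exists 0, 1; split=> //;
    exact: has_value1.
  have [->|g1] := eqVneq g 1%g; first by exists 0, 1; split=> //;
    exact: has_value1.
  have [x gx] : exists x, pullback (f g) x != x.
    apply: NNPP => none; case/eqP: g1; apply: f_faith (AG _ gA) _ => x.
    by apply/eqP/negPn/negP => gx; apply: none; exists x.
  have iterE i y : iter i (pullback (f g)) y = pullback (f (g ^+ i)%g) y.
    by elim: i => [|i IH]; rewrite ?f1 // expgSr fM ?groupX ?AG //= IH.
  suff [gam [y [gamy gam1]]] : exists gam y, has_value mu (pullback phi) gam y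
    /\
      monomial_char gam (delta g) != 1 by exists gam, y.
  apply: (separating_value mu_inj mu_frac (a := pullback (a g)) char_k
    (order_gt0 g) _ _ _ _ _ gx) => [y|p|i|i|y].
  - exact: (aphi _ (AG _ gA)).
  - exact: amu.
  - exact: delta0.
  - by rewrite -deltaX // expg_order delta1.
  by rewrite iterE expg_order f1.
have /fin_all_exists[gam /fin_all_exists[y gamP]] := sep.
(* One value per group element; for those that need no separation any value will do. *)
pose M : 'M[int]_(#|gT|, m) := \matrix_i gam (enum_val i).
have [L [U [B [ME BE Bind]]]] := int_row_echelon M.
have /fin_all_exists[b bB] l : exists b, has_value mu (pullback phi) (row l B)
  b.
  exists (\prod_i y (enum_val i) ^ row l U 0 i);
    rewrite BE row_mul mulmx_sum_row.
  apply: (has_value_sum (row l U 0) (g := fun i => row i M) (x := y \o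
    enum_val)) => i.
  by rewrite rowK; exact: (gamP (enum_val i)).1.
pose S := [set l | row l B != 0].
have leS : (#|S| <= d)%N.
  rewrite leqNgt; apply/negP => ltS.
  pose io (i : 'I_d.+1) : 'I_#|gT| := enum_val (widen_ord ltS i).
  have io_inj : injective io by move=> i i' /enum_val_inj /(congr1 val) /=
    /val_inj.
  apply: (max_d (b \o io));
    apply: (independent_values mu_inj psiC) => [i|w w0 i].
    exact: bB.
  pose W : 'rV[int]_#|gT| := \sum_i w i *: delta_mx 0 (io i).
  have WB : W *m B = 0.
    by rewrite mulmx_suml -[RHS]w0; apply: eq_bigr => l _;
      rewrite -scalemxAl -rowE.
  have := Bind W WB (io i); rewrite summxE (bigD1 i) //= big1 => [|i' i'i].
    rewrite addr0 !mxE !eqxx mulr1; apply.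
    by have := enum_valP (widen_ord ltS i); rewrite inE.
  by rewrite !mxE eqxx eq_sym (inj_eq io_inj) (negPf i'i) mulr0.
(* One character for each nonzero row of [B], completed by trivial characters up to n. *)
pose chi (l : 'I_n) g := if insub (val l) is Some l' then
  monomial_char (row (enum_val (l' : 'I_#|S|)) B) (delta g) else 1.
exists chi; split=> [l g gA|l g h gA hA|g gA chi1].
- rewrite /chi; case: insub => [l'|]; last exact: oner_neq0.
  by apply: monomial_char_neq0 => i; exact: delta0.
- rewrite /chi; case: insub => [l'|]; last by rewrite mulr1.
  by apply: monomial_char_mul => i; exact: deltaM.
apply/eqP; apply: contraT => /((gamP g).2 gA) /eqP[].
(* The separating value of [g] is an integral combination of the rows of [B], so it would be trivial
   on [g] if all the [chi] were. *)
have -> : gam g = row (enum_rank g) M by rewrite rowK enum_rankK.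
have d0 i := delta0 g i gA.
rewrite ME row_mul mulmx_sum_row; elim/big_ind: _ => [|u v u1 v1|l _].
- exact: monomial_char0.
- by rewrite monomial_charD // u1 v1 mulr1.
rewrite monomial_charZ //; have [->|lB] := eqVneq (row l B) 0.
  by rewrite monomial_char0 exp1rz.
have lS : l \in S by rewrite inE.
have := chi1 (widen_ord (leq_trans leS le_dn) (enum_rank_in lS l)).
rewrite /chi /= valK; rewrite enum_rankK_in // => ->.
exact: exp1rz.
Qed.
Local Close Scope ring_scope.

Theorem theorem2 (k : fieldType) (char_k : [pchar k]%R =i pred0)
    (n : nat) (n_ge1 : 1 <= n) (j : nat) (jP : is_jordan_constant k n j)
    (gT : finGroupType) (G : {group gT}) (e : nat) (expG : exponent G = e)
    (root_k : exists z : k, (e.-primitive_root z)%R)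
    (d : nat) (edG : is_ed k G d) :
  (d <= n -> exists2 r, is_rdim k G r & r <= n * j) /\
  (d <= n -> exists f : gT -> Gm_wreath k (n * j),
     {in G &, {morph f : x y / (x * y)%g}} /\ {in G &, injective f}).
Proof.
have b_holds : d <= n -> exists f : gT -> Gm_wreath k (n * j),
    {in G &, {morph f : x y / (x * y)%g}} /\ {in G &, injective f}.
  move=> le_dn; have [[X [f [lin_f dimX]]] _] := edG; have [z prim_z] := root_k.
  have [[_ f1 fM] f_faith [m [rG [a [phi [_ aphi]]]]]] := lin_f.
  have model : unirational_model k G n.
    apply: (unirational_model_le le_dn).
    exists X, (fun g => pullback (f g)), m, (pullback phi); split=> //.
    - by move=> g; exact: pullback_const.
    - exact: pullback_const.
  have [A [nAG abA index_le]] := unirational_model_jordan jP model.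
  have sAG := normal_sub nAG.
  have expGe : exponent G %| e by rewrite expG.
  (* [A] comes from the model of dimension n, its characters from the d-dimensional [X] itself. *)
  have [chi [chi0 chiM chi_inj]] :=
    abelian_characters char_k expGe prim_z sAG abA lin_f dimX le_dn.
  exact: (wreath_embedding sAG index_le n_ge1 chi0 chiM chi_inj).
split=> // /b_holds[f [fM f_inj]]; apply: rdim_exists.
  by rewrite muln_gt0 n_ge1; case: jP.
exact: wreath_faithful fM f_inj.
Qed.
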